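(* Let $\mathbb{G}$ be a Carnot group equipped with its Carnot–Carathéodory distance $d_c$. A universal differentiability set in $\mathbb{G}$ cannot be $\sigma$-porous (with respect to $d_c$).
   Context: A Carnot group of step $s$ is a simply connected finite-dimensional Lie group $\mathbb{G}$ whose Lie algebra decomposes as $\mathfrak{g}=V_1\oplus\cdots\oplus V_s$ with non-zero linear subspaces $V_i$, $[V_1,V_i]=V_{i+1}$ for $1\le i\le s-1$ and $[V_1,V_s]=\{0\}$, where $[V,W]=\mathrm{span}\{[X,Y]:X\in V,Y\in W\}$. Fix a basis $X_1,\dots,X_n$ of $\mathfrak{g}$ (left-invariant vector fields) adapted to the stratification, and let $m=\dim V_1$, so $X_1,\dots,X_m$ is a basis of $V_1$. The point $\exp(x_1X_1+\dots+x_nX_n)$ is identified with $(x_1,\dots,x_n)\in\mathbb{R}^n$; the identity is $0$. For $\lambda>0$ the dilation $\delta_\lambda$ is the linear map on $\mathfrak{g}$ with $\delta_\lambda(X)=\lambda^iX$ for $X\in V_i$, transferred to $\mathbb{G}$ via $\exp\circ\delta_\lambda=\delta_\lambda\circ\exp$. An absolutely continuous curve $\gamma:[a,b]\to\mathbb{G}$ is horizontal if there are $u_1,\dots,u_m\in L^1[a,b]$ with $\gamma'(t)=\sum_{i=1}^m u_i(t)X_i(\gamma(t))$ for a.e. $t$; its length is $L(\gamma)=\int_a^b|u(t)|\,dt$ (Euclidean norm of $u=(u_1,\dots,u_m)$). $d_c(x,y)$ is the infimum of lengths of horizontal curves joining $x$ to $y$; write $d_c(h)=d_c(h,0)$. A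 map $L:\mathbb{G}\to\mathbb{R}$ is group linear if $L(xy)=L(x)+L(y)$ and $L(\delta_r(x))=rL(x)$ for all $x,y\in\mathbb{G}$, $r>0$. A map $f:\mathbb{G}\to\mathbb{R}$ is Pansu differentiable at $x_0$ if there is a group linear $L:\mathbb{G}\to\mathbb{R}$ with $\lim_{h\to0}\frac{f(x_0h)-f(x_0)-L(h)}{d_c(h)}=0$. A universal differentiability set in $\mathbb{G}$ is a subset $A\subset\mathbb{G}$ such that every Lipschitz function $f:\mathbb{G}\to\mathbb{R}$ (with respect to $d_c$) is Pansu differentiable at a point of $A$. Porosity: let $(M,d)$ be a metric space, $E\subset M$, $B(x,r)$ the open ball. For $\lambda\in(0,1)$ and $a\in E$, $E$ is $\lambda$-porous at $a$ if there is a sequence of points $x_k\in M\setminus\{a\}$ with $x_k\to a$ and $B(x_k,\lambda d(x_k,a))\cap E=\varnothing$ for every $k$. $E$ is porous if there is $\lambda\in(0,1)$ (independent of the point) such that $E$ is $\lambda$-porous at every $a\in E$. A set is $\sigma$-porous if it is a countable union of porous sets. *)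

(* Defs.v *)
From HB Require Import structures.
From mathcomp Require Import all_boot all_order all_algebra.
From mathcomp Require Import all_classical all_reals all_analysis.

Set Implicit Arguments.
Unset Strict Implicit.
Unset Printing Implicit Defensive.
Import Order.TTheory GRing.Theory Num.Theory.
Import numFieldNormedType.Exports.

Local Open Scope classical_set_scope.
Local Open Scope ring_scope.

(* C^k for maps between finite-dimensional spaces, by iterated directional
   derivatives. *)
Fixpoint Ck (R : realType) (V W : normedModType R) (k : nat) (f : V -> W) :
    Prop :=
  if k is k'.+1 then
    continuous f /\ forall v : V, (forall x, derivable f x v) /\ Ck k' ('D_v f)
  else continuous f.

Definition smooth (R : realType) (V W : normedModType R) (f : V -> W) : Prop :=
  forall k, Ck k f.

Definition vf_bracket (R : realType) (V : normedModType R) (X Y : V -> V) :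
    V -> V :=
  fun p => 'D_(X p) Y p - 'D_(Y p) X p.

Definition integral_curve (R : realType) (V : normedModType R) (X : V -> V)
    (c : R -> V) : Prop :=
  forall t : R, is_derive t 1 c (X (c t)).

(* Lie groups whose underlying manifold is R^n (in particular simply
   connected), with identity 0. *)
Record lieGroup (R : realType) (n : nat) := LieGroup {
  lg_mul : 'rV[R]_n -> 'rV[R]_n -> 'rV[R]_n;
  lg_inv : 'rV[R]_n -> 'rV[R]_n;
  lg_mulA : associative lg_mul;
  lg_mul0x : left_id 0 lg_mul;
  lg_mulx0 : right_id 0 lg_mul;
  lg_mulVx : left_inverse 0 lg_inv lg_mul;
  lg_mulxV : right_inverse 0 lg_inv lg_mul;
  lg_smooth_mul :
    smooth (fun p : ('rV[R]_n * 'rV[R]_n)%type => lg_mul p.1 p.2);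
  lg_smooth_inv : smooth lg_inv
}.

Section LieAlgebra.
Variables (R : realType) (n : nat) (G : lieGroup R n).

(* The left-invariant vector field with value x at the identity. *)
Definition left_field (x : 'rV[R]_n) : 'rV[R]_n -> 'rV[R]_n :=
  fun p => 'D_x (lg_mul G p) 0.

(* The Lie algebra is identified with the tangent space R^n at 0; the bracket of
   two left-invariant fields is left-invariant, hence given by its value at 0. *)
Definition lie (x y : 'rV[R]_n) : 'rV[R]_n :=
  vf_bracket (left_field x) (left_field y) 0.

(* exp (x_1 X_1 + ... + x_n X_n) = (x_1, ..., x_n), where X_j is
   [left_field (delta_mx 0 j)]: the integral curve t |-> exp (t X) through the
   identity of the field X with coordinates x is t |-> t x. *)
Definition exponential_coordinates : Prop :=
  forall x : 'rV[R]_n, integral_curve (left_field x) (fun t : R => t *: x).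

End LieAlgebra.

Definition is_span (F : fieldType) (V : vectType F) (S : set V)
    (U : {vspace V}) : Prop :=
  (forall x, S x -> x \in U) /\
  (forall W : {vspace V}, (forall x, S x -> x \in W) -> (U <= W)%VS).

(* V_i, for a basis of R^n whose j-th vector is assigned to the layer deg j. *)
Definition layer_of (R : realType) (n : nat) (deg : 'I_n -> nat) (i : nat) :
    {vspace 'rV[R]_n} :=
  span [seq (delta_mx 0 j : 'rV[R]_n) | j <- enum 'I_n & deg j == i].

(* Carnot groups in exponential coordinates with respect to a basis adapted to
   the stratification; the decomposition of R^n into the direct sum of the
   layers is built into [layer_of]. *)
Record carnotGroup (R : realType) := CarnotGroup {
  cg_dim : nat;
  cg_step : nat;
  cg_group :> lieGroup R cg_dim;
  cg_deg : 'I_cg_dim -> nat;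
  cg_exp : exponential_coordinates cg_group;
  cg_step_gt0 : (0 < cg_step)%N;
  cg_deg_bounds : forall j, (1 <= cg_deg j <= cg_step)%N;
  cg_deg_mono : forall j k : 'I_cg_dim, (j <= k)%N -> (cg_deg j <= cg_deg k)%N;
  cg_layer_neq0 : forall i, (1 <= i <= cg_step)%N ->
    layer_of R cg_deg i <> 0%VS;
  cg_bracket : forall i, (1 <= i < cg_step)%N ->
    is_span [set z | exists x y, [/\ x \in layer_of R cg_deg 1,
                       y \in layer_of R cg_deg i & z = lie cg_group x y]]
            (layer_of R cg_deg i.+1);
  cg_bracket_last :
    is_span [set z | exists x y, [/\ x \in layer_of R cg_deg 1,
                       y \in layer_of R cg_deg cg_step & z = lie cg_group x y]]
            0%VS
}.

Definition cg_carrier (R : realType) (G : carnotGroup R) := 'rV[R]_(cg_dim G).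

Definition abs_continuous (R : realType) (V : normedModType R) (a b : R)
    (c : R -> V) : Prop :=
  forall eps : R, 0 < eps -> exists2 delta : R, 0 < delta &
    forall (k : nat) (s t : 'I_k -> R),
      (forall i, a <= s i /\ s i <= t i /\ t i <= b) ->
      (forall i j, i != j -> t i <= s j \/ t j <= s i) ->
      \sum_(i < k) (t i - s i) < delta ->
      \sum_(i < k) `|c (t i) - c (s i)| < eps.

Section CarnotGroupTheory.
Variables (R : realType) (G : carnotGroup R).
Local Notation T := (cg_carrier G).
Local Notation mu := (@lebesgue_measure R).

Definition dilation (r : R) (x : T) : T := \row_j (r ^+ cg_deg j * x 0 j).

Definition basis_field (j : 'I_(cg_dim G)) : T -> T :=
  left_field G (delta_mx 0 j).

(* The controls are the u j with deg j = 1, i.e., j among the first dim V_1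
   indices; the other components of u are ignored. *)
Definition horizontal (a b : R) (c : R -> T) (u : 'I_(cg_dim G) -> R -> R) :
    Prop :=
  [/\ abs_continuous a b c,
      forall j, cg_deg j = 1%N -> mu.-integrable `[a, b] (EFin \o u j) &
      {ae mu, forall t : R, t \in `[a, b] ->
        is_derive t 1 c
          (\sum_(j | cg_deg j == 1%N) u j t *: basis_field j (c t))}].

Definition curve_length (a b : R) (u : 'I_(cg_dim G) -> R -> R) : \bar R :=
  (\int[mu]_(t in `[a, b])
     (Num.sqrt (\sum_(j | cg_deg j == 1%N) u j t ^+ 2))%:E)%E.

(* Extended-real valued so that the infimum needs no convention for the empty
   set; it is finite by Chow's theorem. *)
Definition cc_dist (x y : T) : \bar R :=
  ereal_inf [set l | exists a b c u,
    [/\ a < b, horizontal a b c u, c a = x, c b = y & l = curve_length a b u]].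

Definition cc_lipschitz (f : T -> R) : Prop :=
  exists K : R, forall x y, (`|f x - f y|%:E <= K%:E * cc_dist x y)%E.

Definition group_linear (L : T -> R) : Prop :=
  (forall x y, L (lg_mul G x y) = L x + L y) /\
  (forall (r : R) x, 0 < r -> L (dilation r x) = r * L x).

Definition pansu_differentiable (f : T -> R) (x0 : T) : Prop :=
  exists2 L : T -> R, group_linear L &
    (fun h : T => (f (lg_mul G x0 h) - f x0 - L h) / fine (cc_dist h 0))
      @ (0 : T)^' --> (0 : R).

Definition universal_differentiability_set (A : set T) : Prop :=
  forall f : T -> R, cc_lipschitz f -> exists2 x, A x & pansu_differentiable f x.

End CarnotGroupTheory.

Section Porosity.
Variables (R : realType) (T : Type) (d : T -> T -> \bar R).
Local Open Scope ereal_scope.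

Definition porous_at (E : set T) (lam : R) (a : T) : Prop :=
  exists x : nat -> T,
    [/\ forall k, x k <> a,
        (fun k => d (x k) a) @ \oo --> (0 : \bar R) &
        forall k, [set y | d (x k) y < lam%:E * d (x k) a] `&` E = set0].

Definition porous (E : set T) : Prop :=
  exists lam : R, (0 < lam < 1)%R /\ forall a, E a -> porous_at E lam a.

Definition sigma_porous (E : set T) : Prop :=
  exists F : nat -> set T, (forall k, porous (F k)) /\ E = \bigcup_k F k.

End Porosity.

(* Main.v *)
Require Import Defs.
From mathcomp Require Import all_boot all_order all_algebra.
From mathcomp Require Import all_classical all_reals all_analysis.
From mathcomp Require Import measurable_realfun.
From mathcomp Require Import ring lra.

(** Suppose that A is the union of porous sets E_0, E_1, ... The plan is to
    build one function f, Lipschitz for the distance d_c, that has a Pansu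
    derivative at no point of any E_k.

    A Pansu derivative L of f at a is a homomorphism, so
    L (p h) + L (p h^-1) - 2 L p = 0 for all p and h.  If x, x h and x h^-1 all
    lie at distance O(delta) from a, it follows that the second difference
    f (x h) + f (x h^-1) - 2 f x is o(delta)
    ([second_diff_additive_derivative]).  It therefore suffices that every a in
    E_k sees, at arbitrarily small scales delta, second differences of f of
    size at least a constant times delta, and porosity provides the room to
    create them without touching E_k.

    For each k consider the radii r_k x = min (dist (x, E_k) / 4, rho0) and a
    maximal family S_k of points such that the balls B(x, r_k x), x in S_k, are
    disjoint ([maximal_separated]).  A hole of E_k at distance delta from a has
    radius at least lam * delta, so it meets a ball of the family of comparable
    radius.  Starting from F_0 = 0, put F_(k+1) = F_k + f_k, where f_k is
    4^-k times the sum of the tents r_k x - d_c (x, y) supported on the balls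
    of those x in S_k at which F_k has no second difference of size
    4^-k d_c (h, 0) with d_c (h, 0) comparable to r_k x.  A tent contributes
    - 2 * 4^-k d_c (h, 0), so F_(k+1) has second differences of size at least
    4^-k d_c (h, 0) at all points of S_k ([second_diff_correction]); the terms
    f_j with j > k are Lipschitz with constants adding up to 4^-k / 3 and cannot
    cancel them ([second_diff_full_sum]).  The limit of the F_k is the required
    function ([nowhere_differentiable]).

    What this asks of d_c is the following.  It is symmetric and satisfies the
    triangle inequality because horizontal curves can be reversed and
    concatenated.  It is left invariant because left translations are
    continuously differentiable and their differentials preserve the
    left-invariant fields ([left_field_invariant]), so that they carry
    horizontal curves to horizontal curves of the same length.  It dominates
    the Euclidean norm near 0 ([joined_norm_le]): the horizontal fields are
    bounded near 0, and an absolutely continuous curve c satisfies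
    |c b - c a| <= int |c'| ([abs_continuous_le_integral]).  Finally
    d_c (t e_j, 0) is comparable to t for small t when e_j is a horizontal
    basis vector, because t e_j = exp (t X_j).  Everything is local, and d_c is
    replaced by min (d_c, 1), which is a real number. *)

Set Implicit Arguments.
Unset Strict Implicit.
Unset Printing Implicit Defensive.
Import Order.TTheory GRing.Theory Num.Theory.
Import numFieldNormedType.Exports.

Local Open Scope classical_set_scope.
Local Open Scope ring_scope.

(** * Separated families of balls and sums of tents *)

Section Tents.
Variables (R : realType) (T : Type) (D : T -> T -> R).
Hypothesis D0 : forall x, D x x = 0.
Hypothesis Dsym : forall x y, D x y = D y x.
Hypothesis Dtri : forall x y z, D x z <= D x y + D y z.

Lemma dist_ge0 x y : 0 <= D x y.
Proof. by have := Dtri x y x; rewrite D0 (Dsym y x); lra. Qed.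

Definition dist_to (E : set T) (x : T) : R := inf [set D x e | e in E].

Let dist_to_has_inf E x : E !=set0 -> has_inf [set D x e | e in E].
Proof.
move=> [e Ee]; split; first by exists (D x e); exists e.
by exists 0 => _ [y _ <-]; exact: dist_ge0.
Qed.

Lemma dist_to_le E x e : E e -> dist_to E x <= D x e.
Proof.
by move=> Ee; apply: ge_inf;
  [exact: (dist_to_has_inf _ (ex_intro _ e Ee)).2|exists e].
Qed.

Lemma le_dist_to E x r : E !=set0 -> (forall e, E e -> r <= D x e) ->
  r <= dist_to E x.
Proof.
move=> [e Ee] rD; apply: lb_le_inf; first by exists (D x e); exists e.
by move=> _ [y Ey <-]; exact: rD.
Qed.

Lemma dist_to_lip E x y : dist_to E x <= dist_to E y + D x y.
Proof.
have [->|E0] := eqVneq E set0.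
  by rewrite /dist_to !image_set0 inf0 add0r dist_ge0.
move/set0P in E0; rewrite -lerBlDr; apply: le_dist_to => // e Ee.
by have := dist_to_le x Ee; have := Dtri x y e; lra.
Qed.

Definition separated (r : T -> R) (S : set T) :=
  (forall x, S x -> 0 < r x) /\
  (forall x y, S x -> S y -> x <> y -> r x + r y <= D x y).

(** Zorn's lemma.  A point z with r z > 0 that violated the conclusion could be
    added to a maximal separated set. *)
Lemma maximal_separated (r : T -> R) : exists S, separated r S /\
  forall z, 0 < r z -> exists2 x, S x & D x z < r x + r z.
Proof.
have [|S [sepS maxS]] := @Zorn_bigcup T (separated r).
  move=> F sepF totF; split=> [x [S FS Sx]|x y [S FS Sx] [S' FS' Sy] xy].
    exact: (sepF _ FS).1.
  by have [SS'|SS'] := totF _ _ FS FS';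
    [apply: (sepF _ FS').2|apply: (sepF _ FS).2];
    auto.
exists S; split=> // z rz; apply: contrapT => noz.
have far x : S x -> r x + r z <= D x z.
  by move=> Sx; rewrite leNgt; apply/negP => ?; apply: noz; exists x.
have Sz : ~ S z by move=> /far; rewrite D0; lra.
apply: (maxS (S `|` [set z])).
  by split; [exact: subsetUl|move=> /(_ z); apply: contra_not Sz; apply; right].
split=> [x [|->//]|x y [Sx|->] [Sy|->]//]; first exact: sepS.1.
- exact: sepS.2.
- by move=> _; exact: far.
- by rewrite addrC Dsym => _; exact: far.
Qed.

Variables (r : T -> R).
Hypothesis r1 : forall x, r x <= 1.

(** The value 0 is put into the set so that the supremum is also the right one
    away from all tents.  For a separated S the tents have disjoint supports,
    and this supremum is their sum; as a supremum of 1-Lipschitz functions it is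
    1-Lipschitz at once. *)
Definition tents (S : set T) (y : T) : R :=
  sup [set v | v = 0 \/ exists2 x, S x & v = r x - D x y].

Let tents_has_sup S y :
  has_sup [set v | v = 0 \/ exists2 x, S x & v = r x - D x y].
Proof.
split; first by exists 0; left.
exists 1 => v [->//|[x _ ->]].
by have := dist_ge0 x y; have := r1 x; lra.
Qed.

Lemma tents_ge0 S y : 0 <= tents S y.
Proof. by apply: ub_le_sup; [exact: (tents_has_sup _ _).2|left]. Qed.

Lemma tents_ge S x y : S x -> r x - D x y <= tents S y.
Proof.
by move=> Sx; apply: ub_le_sup; [exact: (tents_has_sup _ _).2|right; exists x].
Qed.

Lemma tents_le S y v : 0 <= v -> (forall x, S x -> r x - D x y <= v) ->
  tents S y <= v.
Proof.
move=> v0 vS; apply: ge_sup; first by exists 0; left.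
by move=> _ [->//|[x Sx ->]]; exact: vS.
Qed.

Lemma tents_le1 S y : tents S y <= 1.
Proof.
by apply: tents_le => // x _; have := dist_ge0 x y; have := r1 x; lra.
Qed.

Lemma tents_lip S y z : `|tents S y - tents S z| <= D y z.
Proof.
have half a b : tents S a <= tents S b + D a b.
  apply: tents_le; first by rewrite addr_ge0 ?tents_ge0 ?dist_ge0.
  by move=> x Sx; have := tents_ge b Sx; have := Dtri x a b; lra.
by have := half y z; have := half z y; rewrite (Dsym z y) ler_norml; lra.
Qed.

Lemma tents_at S S' x y : separated r S -> S' `<=` S -> S' x -> D x y <= r x ->
  tents S' y = r x - D x y.
Proof.
move=> sepS S'S S'x xy; apply/eqP; rewrite eq_le tents_ge// andbT.
apply: tents_le => [|z S'z]; first lra.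
have [->//|zx] := pselect (z = x).
have := sepS.2 _ _ (S'S _ S'z) (S'S _ S'x) zx.
by have := Dtri z y x; rewrite (Dsym y x); lra.
Qed.

Lemma tents_off S S' x y : separated r S -> S' `<=` S -> S x -> ~ S' x ->
  D x y <= r x -> tents S' y = 0.
Proof.
move=> sepS S'S Sx S'x xy; apply/eqP; rewrite eq_le tents_ge0 andbT.
apply: tents_le => // z S'z.
have zx : z <> x by move=> zx; apply: S'x; rewrite -zx.
have := sepS.2 _ _ (S'S _ S'z) Sx zx.
by have := Dtri z y x; rewrite (Dsym y x); lra.
Qed.

End Tents.

(** * A Lipschitz function without additive derivatives on porous sets *)

Section Group.
Variables (R : realType) (T : Type).
Variables (mul : T -> T -> T) (inv : T -> T) (one : T) (D : T -> T -> R).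
Hypothesis mulA : associative mul.
Hypothesis mul1g : left_id one mul.
Hypothesis mulg1 : right_id one mul.
Hypothesis mulgV : right_inverse one inv mul.
Hypothesis D0 : forall x, D x x = 0.
Hypothesis Dsym : forall x y, D x y = D y x.
Hypothesis Dtri : forall x y z, D x z <= D x y + D y z.
Hypothesis Dleft : forall q x y, D (mul q x) (mul q y) = D x y.

Lemma dist_mulr x h : D x (mul x h) = D h one.
Proof. by rewrite -{1}(mulg1 x) Dleft Dsym. Qed.

Lemma dist_inv h : D (inv h) one = D h one.
Proof. by rewrite -(Dleft h) mulgV mulg1 Dsym. Qed.

Definition second_diff (F : T -> R) x h :=
  F (mul x h) + F (mul x (inv h)) - 2 * F x.

Lemma second_diffD F F' x h :
  second_diff (fun y => F y + F' y) x h =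
  second_diff F x h + second_diff F' x h.
Proof. by rewrite /second_diff; ring. Qed.

(** Left invariance and symmetry make x h and x h^-1 equidistant from x. *)
Lemma second_diff_lip F c x h : (forall y z, `|F y - F z| <= c * D y z) ->
  `|second_diff F x h| <= 2 * c * D h one.
Proof.
move=> FL; have -> : second_diff F x h =
  (F (mul x h) - F x) + (F (mul x (inv h)) - F x) by rewrite /second_diff; ring.
have e1 := FL (mul x h) x; have e2 := FL (mul x (inv h)) x.
rewrite Dsym dist_mulr in e1; rewrite Dsym dist_mulr dist_inv in e2.
by rewrite (le_trans (ler_normD _ _))//; lra.
Qed.

Variables (c0 rho0 : R) (H : R -> T).
Hypothesis c0_gt0 : 0 < c0.
Hypothesis rho01 : 0 < rho0 <= 1.
Hypothesis HP : forall rho : R, 0 < rho <= rho0 ->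
  c0 * rho <= D (H rho) one <= rho.

(** One step of the construction: F is the current partial sum, H rho is a group
    element whose distance to the identity is comparable to rho, and r and S are
    the radii and the separated set attached to one porous set. *)
Section Step.
Variables (r : T -> R) (S : set T) (F : T -> R) (c : R).
Hypothesis r_rho0 : forall x, r x <= rho0.
Hypothesis sepS : separated D r S.
Hypothesis c_gt0 : 0 < c.

(** The points of S that still need a tent. *)
Definition flat_points :=
  S `&` [set x | `|second_diff F x (H (r x))| < c * D (H (r x)) one].

Definition correction (y : T) := c * tents D r flat_points y.

Let r1 x : r x <= 1.
Proof. by rewrite (le_trans (r_rho0 x))//; case/andP: rho01. Qed.

Lemma correction_ge0 y : 0 <= correction y.
Proof. by apply: mulr_ge0; [exact: ltW|exact: tents_ge0]. Qed.

Lemma correction_lec y : correction y <= c.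
Proof. by apply: ler_piMr; [exact: ltW|exact: tents_le1]. Qed.

Lemma correction_lip y z : `|correction y - correction z| <= c * D y z.
Proof.
rewrite /correction -mulrBr normrM gtr0_norm// ler_pM2l//; exact: tents_lip.
Qed.

(** Inside the ball of a point of S at most one tent is nonzero.  At a flat
    point that tent changes the second difference by - 2 c D (H (r x)) one, more
    than twice what was there in absolute value; at the other points of S
    nothing is changed. *)
Lemma second_diff_correction x : S x ->
  c * D (H (r x)) one <=
  `|second_diff (fun y => F y + correction y) x (H (r x))|.
Proof.
move=> Sx; rewrite second_diffD.
have rx : 0 < r x <= rho0 by rewrite sepS.1//=.
set h := H (r x); have /andP[hl hr] := HP rx; rewrite -/h in hl hr.
have sub : flat_points `<=` S by move=> ? [].
have d1 : D x (mul x h) = D h one by rewrite dist_mulr.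
have d2 : D x (mul x (inv h)) = D h one by rewrite dist_mulr dist_inv.
have [Fx|Fx] := pselect (flat_points x); last first.
  have -> : second_diff correction x h = 0.
    rewrite /second_diff /correction.
    by rewrite !(tents_off D0 Dsym Dtri r1 sepS sub Sx Fx)
      ?d1 ?d2 ?D0 ?mulr0 ?subr0 ?addr0//; lra.
  by rewrite addr0 leNgt; apply/negP => ?; apply: Fx.
have -> : second_diff correction x h = - (2 * (c * D h one)).
  rewrite /second_diff /correction !(tents_at D0 Dsym Dtri r1 sepS sub Fx)
    ?d1 ?d2 ?D0//; [by ring|lra].
have := Fx.2 => /=; rewrite -/h; move: (second_diff F x h) => s.
set t := c * _; rewrite ltr_norml => /andP[_ st].
by rewrite ler_normr; apply/orP; right; lra.
Qed.

End Step.

Section Series.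
Variables (r : nat -> T -> R) (S : nat -> set T).
Hypothesis r_rho0 : forall k x, r k x <= rho0.
Hypothesis sepS : forall k, separated D (r k) (S k).

Let c (k : nat) : R := 4^-1 ^+ k.

Let c_gt0 k : 0 < c k.
Proof. by rewrite exprn_gt0. Qed.

Fixpoint partial_sum (k : nat) : T -> R :=
  if k is k'.+1 then
    fun y => partial_sum k' y
      + correction (r k') (S k') (partial_sum k') (c k') y
  else fun=> 0.

(** The geometric series 4^-k + ... + 4^-(k + m - 1), in closed form. *)
Lemma partial_sum_lip k m y z :
  `|(partial_sum (k + m) y - partial_sum k y)
    - (partial_sum (k + m) z - partial_sum k z)| <=
  4 / 3 * (c k - c (k + m)) * D y z.
Proof.
elim: m => [|m IHm]; first by rewrite addn0 !subrr !(mulr0, mul0r) normr0.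
rewrite addnS /=.
have := correction_lip (S (k + m)) (partial_sum (k + m)) (r_rho0 (k + m))
  (c_gt0 (k + m)) y z.
set a := correction _ _ _ _ y; set b := correction _ _ _ _ z.
move: IHm.
have -> : c (k + m).+1 = 4^-1 * c (k + m) by rewrite /c exprS.
set A := (X in `|X|); set B := (X in _ -> `|X| <= _ -> _) => HA HB.
rewrite (_ : _ - _ - _ = A + B); last by rewrite /A /B; ring.
rewrite (le_trans (ler_normD _ _))//.
have := lerD HA HB; move=> /le_trans; apply.
by rewrite le_eqVlt; apply/orP; left; apply/eqP; field.
Qed.

Lemma partial_sum_nd y : nondecreasing_seq (partial_sum ^~ y).
Proof.
apply/nondecreasing_seqP => n /=.
by rewrite lerDl; apply: correction_ge0.
Qed.

Lemma partial_sum_le n y : partial_sum n y <= 4 / 3 * (1 - c n).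
Proof.
elim: n => [|n IHn]; first by rewrite /c expr0 subrr mulr0.
have -> : c n.+1 = 4^-1 * c n by rewrite /c exprS.
have := correction_lec (S n) (partial_sum n) (r_rho0 n) (c_gt0 n) y.
by rewrite /=; lra.
Qed.

Definition full_sum (y : T) : R := limn (partial_sum ^~ y).

Lemma full_sum_cvg y : partial_sum ^~ y @ \oo --> full_sum y.
Proof.
apply: nondecreasing_is_cvgn; first exact: partial_sum_nd.
exists (4 / 3) => _ [n _ <-]; rewrite (le_trans (partial_sum_le n y))//.
by have := c_gt0 n; lra.
Qed.

Lemma full_sum_lip k y z :
  `|(full_sum y - partial_sum k y) - (full_sum z - partial_sum k z)| <=
  4 / 3 * c k * D y z.
Proof.
have cv : (fun n => `|(partial_sum n y - partial_sum k y)
    - (partial_sum n z - partial_sum k z)|) @ \oo -->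
    `|(full_sum y - partial_sum k y) - (full_sum z - partial_sum k z)|.
  by apply: cvg_norm; apply: cvgB; apply: cvgB;
    [exact: full_sum_cvg|exact: cvg_cst
    |exact: full_sum_cvg|exact: cvg_cst].
rewrite -(cvg_lim _ cv)//; apply: limr_le; first by apply/cvg_ex; eexists;
  exact: cv.
near=> n.
have kn : (k <= n)%N by near: n; exact: nbhs_infty_ge.
rewrite -(subnKC kn) (le_trans (partial_sum_lip _ _ _ _))// ler_wpM2r
  ?dist_ge0//.
by have := c_gt0 (k + (n - k)); lra.
Unshelve. all: by end_near. Qed.

(** The sum of the later terms has Lipschitz constant at most 4^-k / 3, so it
    moves the second difference by at most 2/3 of 4^-k D (H (r k x)) one. *)
Lemma second_diff_full_sum k x : S k x ->
  3^-1 * c k * D (H (r k x)) one <= `|second_diff full_sum x (H (r k x))|.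
Proof.
move=> Skx.
have -> : full_sum =
    fun y => partial_sum k.+1 y + (full_sum y - partial_sum k.+1 y).
  by apply/funext => y; rewrite addrC subrK.
rewrite second_diffD.
have e1 := second_diff_correction (partial_sum k) (c k) (r_rho0 k) (sepS k) Skx.
have e2 := second_diff_lip x (H (r k x)) (full_sum_lip k.+1).
have e3 : c k.+1 = 4^-1 * c k by rewrite /c exprS.
rewrite e3 in e2.
set a := second_diff _ _ _ in e1;
  rewrite -[second_diff (partial_sum k.+1) _ _]/a.
set b := second_diff _ _ _ in e2 *.
have := ler_normB (a + b) b; rewrite addrK => e4.
set d := D _ _ in e1 e2 *.
have e5 : 2 * (4 / 3 * (4^-1 * c k)) * d = 2 / 3 * (c k * d) by field.
have e6 : 3^-1 * c k * d = 3^-1 * (c k * d) by ring.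
lra.
Qed.

End Series.

(** Let z be the centre of a hole of E k at distance delta from a, so that
    r k z is between min lam 1 * delta / 4 and delta / 4.  Maximality of S k
    gives x in S k with D x z < r k x + r k z; as r k is 1/4-Lipschitz, r k x
    and r k z differ by a factor at most 5/3.  Hence x is within 2 * delta of a
    and the second difference at x is at least a fixed multiple of delta. *)
Lemma function_with_large_second_diffs (E : nat -> set T) :
  (forall k, exists2 lam : R, 0 < lam & forall a, E k a ->
    forall eta : R, 0 < eta -> exists2 z, 0 < D z a < eta &
      forall y, E k y -> lam * D z a <= D z y) ->
  exists2 f : T -> R, (forall y z, `|f y - f z| <= 2 * D y z) &
    forall k a, E k a -> exists2 theta : R, 0 < theta &
      forall eta : R, 0 < eta -> exists (delta : R) x h,
        [/\ 0 < delta < eta, D x a <= 2 * delta, D h one <= delta &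
          theta * delta <= `|second_diff f x h|].
Proof.
move=> porE.
pose r k x := Num.min (4^-1 * dist_to D (E k) x) rho0.
have r_rho0 k x : r k x <= rho0 by rewrite ge_min lexx orbT.
pose S k := projT1 (cid (maximal_separated D0 Dsym (r k))).
have sepS k : separated D (r k) (S k) :=
  (projT2 (cid (maximal_separated D0 Dsym (r k)))).1.
have maxS k := (projT2 (cid (maximal_separated D0 Dsym (r k)))).2.
have r_lip k x y : r k x <= r k y + 4^-1 * D x y.
  have := dist_to_lip D0 Dsym Dtri (E k) x y; have := dist_ge0 D0 Dsym Dtri x y.
  rewrite /r; move: (dist_to _ _ _) (dist_to _ _ _) (D _ _) => A B C C0 ABC.
  by rewrite /Num.min; case: ifP => // ?; case: ifP => // ?; lra.
exists (full_sum r S).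
  move=> y z; have := full_sum_lip S r_rho0 0 y z.
  rewrite /= !subr0 expr0 => /le_trans; apply.
  by rewrite ler_wpM2r ?dist_ge0//; lra.
move=> k a Eka; have [lam lam0 porEk] := porE k.
(* 3/20 comes from r k x >= 3/5 * r k z and r k z >= min lam 1 * D z a / 4. *)
exists (3^-1 * 4^-1 ^+ k * (c0 * (3 / 20 * Num.min lam 1))).
  by rewrite !mulr_gt0 ?exprn_gt0// lt_min lam0/=.
move=> eta eta0.
have [rho0_gt0 _] := andP rho01.
have /(porEk a Eka)[z] : 0 < Num.min eta rho0.
  by rewrite lt_min eta0.
rewrite lt_min => /and3P[za0 za1 za2] zE.
have lam1 : 0 < Num.min lam 1 <= 1.
  by rewrite lt_min lam0 ge_min lexx orbT !andbT/=.
have rz1 : r k z <= 4^-1 * D z a.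
  by rewrite ge_min; apply/orP; left; rewrite ler_pM2l// dist_to_le.
have rz2 : 4^-1 * (Num.min lam 1 * D z a) <= r k z.
  rewrite le_min; apply/andP; split.
    rewrite ler_pM2l//; apply: le_dist_to; first by exists a.
    by move=> e /zE; apply: le_trans; rewrite ler_pM2r// ge_min lexx.
  have : Num.min lam 1 * D z a <= D z a.
    by rewrite ler_piMl ?(ltW za0)//; case/andP: lam1.
  lra.
have rz0 : 0 < r k z.
  by apply: lt_le_trans rz2; rewrite !mulr_gt0//; case/andP: lam1.
have [x Sx xz] := maxS k z rz0.
have rx1 := r_lip k x z; have rx2 := r_lip k z x; rewrite (Dsym z x) in rx2.
have rx0 := (sepS k).1 _ Sx.
exists (D z a), x, (H (r k x)).
have /HP/andP[hl hr] : 0 < r k x <= rho0 by rewrite rx0 r_rho0.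
split; first by rewrite za0 za1.
- by have := Dtri x z a; lra.
- by lra.
- apply: le_trans (second_diff_full_sum r_rho0 sepS Sx).
  rewrite -[leLHS]mulrA ler_pM2l ?mulr_gt0 ?exprn_gt0//.
  apply: le_trans hl; rewrite -[leLHS]mulrA ler_pM2l//.
  move: rz2; set m := Num.min lam 1 * D z a => rz2.
  have -> : 3 / 20 * Num.min lam 1 * D z a = 3 / 20 * m by rewrite /m mulrA.
  lra.
Qed.

(** A Pansu derivative without the homogeneity under dilations. *)
Definition additive_derivative (f L : T -> R) (a : T) :=
  (forall p q, L (mul p q) = L p + L q) /\
  forall eps : R, 0 < eps -> exists2 eta : R, 0 < eta &
    forall p, D p one < eta -> `|f (mul a p) - f a - L p| <= eps * D p one.

(** The three points x, x h and x h^-1 are within 3 * delta of a.  Replacing f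
    by its first-order expansion at a at each of them costs a small multiple of
    delta, and the second difference of the expansion vanishes as L is
    additive. *)
Lemma second_diff_additive_derivative f L a theta : additive_derivative f L a ->
  0 < theta ->
  exists2 eta : R, 0 < eta & forall (delta : R) x h, 0 < delta < eta ->
    D x a <= 2 * delta -> D h one <= delta ->
    `|second_diff f x h| < theta * delta.
Proof.
move=> [LM dL] theta0.
(* The expansion of f is used four times, counting the point x twice, with an
   error of at most theta / 20 * (3 * delta) each time. *)
have [|eta eta0 fL] := dL (theta / 20); first by rewrite divr_gt0.
exists (eta / 4); first lra.
move=> delta x h /andP[d0 d1] xa hd.
have L1 : L one = 0 by have := LM one one; rewrite mul1g; lra.
have LV p : L (inv p) = - L p by have := LM p (inv p); rewrite mulgV L1; lra.
have key y : D y a <= 3 * delta ->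
    `|f y - f a - (L y - L a)| <= theta * (3 / 20 * delta).
  move=> ya; have Dp : D (mul (inv a) y) one = D y a.
    by rewrite -(Dleft a) mulA mulgV mul1g mulg1.
  have := fL (mul (inv a) y); rewrite Dp mulA mulgV mul1g LM LV addrC.
  rewrite [- L a + _]addrC addrC => /(_ _)/le_trans; apply; first by lra.
  by rewrite -[leLHS]mulrA ler_pM2l//; lra.
have e0 : D x a <= 3 * delta by lra.
have e1 : D (mul x h) a <= 3 * delta.
  by have := Dtri (mul x h) x a; rewrite (Dsym _ x) dist_mulr; lra.
have e2 : D (mul x (inv h)) a <= 3 * delta.
  by have := Dtri (mul x (inv h)) x a; rewrite (Dsym _ x) dist_mulr dist_inv;
    lra.
have k0 := key _ e0; have k1 := key _ e1; have k2 := key _ e2.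
rewrite LM in k1; rewrite LM LV in k2.
have td : 0 < theta * delta by rewrite mulr_gt0.
have e3 : theta * (3 / 20 * delta) = 3 / 20 * (theta * delta) by ring.
rewrite e3 in k0 k1 k2.
move: k0 k1 k2; rewrite /second_diff !ler_norml ltr_norml.
by move=> /andP[k0 k0'] /andP[k1 k1'] /andP[k2 k2']; apply/andP; split; lra.
Qed.

Lemma nowhere_differentiable (E : nat -> set T) :
  (forall k, exists2 lam : R, 0 < lam & forall a, E k a ->
    forall eta : R, 0 < eta -> exists2 z, 0 < D z a < eta &
      forall y, E k y -> lam * D z a <= D z y) ->
  exists2 f : T -> R, (forall y z, `|f y - f z| <= 2 * D y z) &
    forall k a, E k a -> forall L, ~ additive_derivative f L a.
Proof.
move=> /function_with_large_second_diffs[f flip fE]; exists f => // k a Ea L dL.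
have [theta theta0 big] := fE k a Ea.
have [eta /big [delta [x [h [d xa hd large]]]] small] :=
  second_diff_additive_derivative dL theta0.
by have := small _ _ _ d xa hd; rewrite ltNge large.
Qed.

End Group.

(** * Absolutely continuous curves *)

Section AbsContinuous.
Variable R : realType.
Local Notation mu := (@lebesgue_measure R).

(** Induction along a segment: the supremum of the points reached from a by P is
    reached, and can be passed unless it is b. *)
Lemma segment_induction (a b : R) (P : R -> Prop) : a <= b -> P a ->
  (forall x, a <= x <= b -> exists2 eta : R, 0 < eta &
    forall s t, a <= s -> x - eta < s -> s <= x -> x <= t -> t < x + eta ->
      t <= b -> P s -> P t) ->
  P b.
Proof.
move=> ab Pa step; pose A := [set t | a <= t <= b /\ P t].
have Aa : A a by split; rewrite ?lexx.
have supA : has_sup A.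
  by split; [exists a|exists b => t [/andP[]]].
pose m := sup A.
have am : a <= m by apply: ub_le_sup => //; case: supA.
have mb : m <= b by apply: ge_sup; [exists a|move=> t [/andP[]]].
have [|eta eta0 mstep] := step m; first by rewrite am.
have [s [/andP[as_ sb] Ps] ms] : exists2 s, A s & m - eta < s.
  by apply: sup_adherent.
have sm : s <= m by apply: ub_le_sup; [case: supA|split=> //; rewrite as_].
have : A (Num.min b (m + eta / 2)).
  split; last first.
    apply: (mstep s) => //; rewrite ?ge_min ?lexx// ?le_min ?mb/=; first lra.
    by rewrite gt_min; apply/orP; right; lra.
  by rewrite le_min ab ge_min lexx/= andbT; lra.
move=> /(ub_le_sup supA.2); rewrite -/m => mle.
have bm : b <= m.
  by move: mle; rewrite ge_min => /orP[//|]; lra.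
have -> : b = m by apply/eqP; rewrite eq_le bm mb.
by apply: (mstep s) => //; lra.
Qed.

Lemma is_derive_approx (V : normedModType R) (c : R -> V) (x : R) (v : V) :
  is_derive x 1 c v -> forall eps : R, 0 < eps ->
  exists2 eta : R, 0 < eta & forall y, `|y - x| < eta ->
    `|c y - c x - (y - x) *: v| <= eps * `|y - x|.
Proof.
move=> [dc cv] eps eps0; move/derivable_nbhs: dc; rewrite cv.
move=> /eqaddoP /(_ eps eps0) /nbhs_ballP[eta /= eta0 ceta].
exists eta => // y yx; have := ceta (y - x).
rewrite /ball/= sub0r normrN => /(_ yx).
by rewrite /cst !fctE/= [(y - x)%:A]mulr1 subrK opprD addrA.
Qed.

(** Differentiability at x compares the values at two points on opposite sides
    of x; this is the shape that induction along a segment asks for. *)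
Lemma is_derive_straddle (V : normedModType R) (c : R -> V) (x : R) (v : V) :
  is_derive x 1 c v -> forall eps : R, 0 < eps ->
  exists2 eta : R, 0 < eta & forall s t, x - eta < s -> s <= x -> x <= t ->
    t < x + eta -> `|c t - c s - (t - s) *: v| <= eps * (t - s).
Proof.
move=> dc eps eps0; have [eta eta0 ceta] := is_derive_approx dc eps0.
exists eta => // s t etas sx xt teta.
have := ceta t; rewrite ger0_norm ?subr_ge0// => /(_ _)/wrap[|e1]; first lra.
have := ceta s; rewrite ler0_norm ?subr_le0// => /(_ _)/wrap[|e2]; first lra.
have -> : c t - c s - (t - s) *: v =
    (c t - c x - (t - x) *: v) - (c s - c x - (s - x) *: v).
  have -> : t - s = (t - x) - (s - x) by ring.
  have -> : c t - c s = (c t - c x) - (c s - c x) by rewrite opprB addrA subrK.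
  by rewrite scalerBl !opprD !opprK addrACA.
by rewrite (le_trans (ler_normB _ _))//; lra.
Qed.

Lemma negligible_small_open (N : set R) (delta : R) : mu.-negligible N ->
  0 < delta -> exists U : set R, [/\ open U, N `<=` U & (mu U < delta%:E)%E].
Proof.
move=> [N' [mN' muN' NN']] delta0.
have N'0 : mu N' = 0%E by exact: muN'.
have finN' : (mu N' < +oo)%E by rewrite N'0 ltry.
have [U [oU N'U UN']] := lebesgue_regularity_outer mN' finN' delta0.
exists U; split=> //; first exact: subset_trans N'U.
have mU : measurable U by exact: open_measurable.
rewrite -(setDUK N'U) measureU//=; last by rewrite setDIK.
  by rewrite N'0 add0e.
exact: measurableD.
Qed.

(** Let N be the null set where c or the primitive F of g fails to have the
    expected derivative, and U an open set of small measure around N.  Induction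
    along [a, b] shows that |c t - c a| is at most F t + eps (t - a) plus the
    variation of c over finitely many disjoint intervals contained in U: near a
    point outside U the derivatives of c and F are compared, and near a point
    of U one more interval is added.  Absolute continuity bounds the last term,
    as the total length of the intervals is at most the measure of U. *)
Lemma abs_continuous_le_integral (V : normedModType R) (c : R -> V) (g : R -> R)
    (a b : R) : a <= b -> abs_continuous a b c ->
  mu.-integrable setT (EFin \o g) -> (forall x, 0 <= g x) ->
  {ae mu, forall t, t \in `[a, b] ->
    exists2 v, is_derive t 1 c v & `|v| <= g t} ->
  `|c b - c a| <= \int[mu]_(t in `[a, b]) g t.
Proof.
move=> ab acc ig g0 dc.
pose F y := \int[mu]_(t in `[a, y]) g t.
have igA A : measurable A -> mu.-integrable A (EFin \o g).
  by move=> mA; apply: integrableS ig.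
have mg A : measurable A -> measurable_fun A (EFin \o g).
  by move=> /igA/integrableP[].
have finA A : measurable A -> (\int[mu]_(t in A) (g t)%:E)%E \is a fin_num.
  by move=> mA; apply: integrable_fin_num => //; exact: igA.
have F_nd s t : s <= t -> F s <= F t.
  move=> st; rewrite /F /Rintegral fine_le ?finA//.
  apply: ge0_subset_integral => //.
  - exact: mg.
  - by move=> x _; rewrite lee_fin.
  - by apply: subset_itvl; rewrite bnd_simp.
have Fa : F a = 0 by rewrite /F set_itv1 Rintegral_set1.
have dF : {ae mu, forall x, a < x -> derivable F x 1 /\ derive1 F x = g x}.
  have lg : locally_integrable setT g.
    have := @integrable_locally R g setT measurableT ig.
    by rewrite patch_setT.
  have := FTC1 (fun y => igA _ (measurable_itv `[a, y])) lg.
  apply: filterS; first exact: (ae_filter_ringOfSetsType mu).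
  by move=> x H ax; exact: H.
have [N negN PN] : exists2 N, mu.-negligible N & forall x, ~ N x ->
    a < x -> x \in `[a, b] -> exists2 v, is_derive x 1 c v &
      `|v| <= g x /\ is_derive x 1 F (g x).
  have H := @filterI _ _ (ae_filter_ringOfSetsType mu) _ _ dF dc.
  exists (~` [set x | (a < x -> derivable F x 1 /\ derive1 F x = g x) /\
    (x \in `[a, b] -> exists2 v, is_derive x 1 c v & `|v| <= g x)]).
    exact: H.
  move=> x /contrapT[H1 H2] ax /H2[v dv vg]; exists v => //; split=> //.
  have [d1 d2] := H1 ax.
  exact: (DeriveDef d1 (etrans (esym (derive1E _ _)) d2)).
apply/ler_addgt0Pr => e e0; rewrite -[X in _ <= X + _]/(F b).
pose eps := e / (b - a + 1).
have ba0 : 0 < b - a + 1 by lra.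
have eps0 : 0 < eps by rewrite divr_gt0.
have [delta delta0 ac] := acc _ eps0.
(* The derivative of F is known only to the right of a, so a joins N. *)
have negN' : mu.-negligible (N `|` [set a]).
  apply: negligibleU => //; apply/negligibleP => //;
    exact: lebesgue_measure_set1.
have [U [oU NU Udelta]] := negligible_small_open negN' delta0.
have mU : measurable U by exact: open_measurable.
(* P t controls c on [a, t]: the variation of c over the k disjoint intervals
   [x i, y i] is set aside, and their lengths are charged to U. *)
pose P (t : R) := exists k (x y : nat -> R), [/\
  forall i, (i < k)%N -> a <= x i /\ x i <= y i /\ y i <= t,
  forall i j, (i < k)%N -> (j < k)%N -> i != j -> y i <= x j \/ y j <= x i,
  ((\sum_(i < k) (y i - x i))%:E <= mu (U `&` `]a, t]))%E &
  `|c t - c a| <= F t + eps * (t - a) + \sum_(i < k) `|c (y i) - c (x i)|].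
suff [k [x [y [xy disj lenU cle]]]] : P b.
  apply: le_trans cle _.
  have small : \sum_(i < k) (y i - x i) < delta.
    rewrite -lte_fin; apply: le_lt_trans lenU _; apply: le_lt_trans Udelta.
    by rewrite le_measure// ?inE//; exact: measurableI.
  have := ac k (fun i => x i) (fun i => y i) (fun i => xy i (ltn_ord i)) _
    small.
  move=> /(_ _)/wrap[|cs].
    by move=> i j ij; exact: disj.
  have : eps * (b - a) + eps = e by rewrite /eps; field; rewrite gt_eqF.
  lra.
apply: (segment_induction ab).
  exists 0%N, (fun=> 0), (fun=> 0); split=> //.
    by rewrite big_ord0 measure_ge0.
  by rewrite big_ord0 !subrr normr0 Fa mulr0 !addr0.
move=> z zab.
(* Going from s to t without a new interval. *)
have step_gap s t : s <= t -> a <= s ->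
    `|c t - c s| <= F t - F s + eps * (t - s) -> P s -> P t.
  move=> st as_ cst [k [x [y [xy disj lenU cle]]]]; exists k, x, y; split=> //.
  - by move=> i /xy[? [? ?]]; split=> //; split=> //; lra.
  - apply: (le_trans lenU); rewrite le_measure// ?inE; [exact: measurableI..|].
    by apply: setIS; apply: subset_itvl; rewrite bnd_simp.
  - have -> : c t - c a = (c t - c s) + (c s - c a) by rewrite addrA subrK.
    by rewrite (le_trans (ler_normD _ _))//; lra.
have [Uz|Uz] := pselect (U z).
  have /nbhs_ballP[eta /= eta0 zU] : nbhs z U by apply: open_nbhs_nbhs.
  exists eta => // s t as_ etas sz zt teta tb [k [x [y [xy disj lenU cle]]]].
  have stU : `]s, t] `<=` U.
    move=> w /=; rewrite in_itv/= => /andP[sw wt]; apply: zU.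
    by rewrite /ball/= ltr_norml; lra.
  exists k.+1, (fun i => if i == k then s else x i),
    (fun i => if i == k then t else y i).
  have sumE (f h : nat -> R) (w : R) (G : R -> R -> R) :
      \sum_(i < k.+1) G (if i == k :> nat then s else f i)
        (if i == k :> nat then t else h i)
      = \sum_(i < k) G (f i) (h i) + G s t.
    rewrite big_ord_recr/= eqxx; congr (_ + _).
    by apply: eq_bigr => i _; rewrite ltn_eqF.
  split.
  - move=> i; rewrite ltnS leq_eqVlt; have [->|ik]/= := eqVneq i k.
      by move=> _; lra.
    by move=> /xy; lra.
  - move=> i j; rewrite !ltnS (leq_eqVlt i) (leq_eqVlt j).
    have [->|ik]/= := eqVneq i k; have [->|jk]/= := eqVneq j k; rewrite ?eqxx//.
    + by move=> _ /xy [? []]; right; lra.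
    + by move=> /xy [? []]; left; lra.
    + exact: disj.
  - rewrite (sumE x y 0 (fun p q => q - p)) EFinD.
    have -> : U `&` `]a, t] = (U `&` `]a, s]) `|` `]s, t].
      apply/seteqP; split=> w /=; rewrite !in_itv/=.
        move=> [Uw /andP[aw wt]]; have [sw|ws] := ltP s w; [right|left].
          by rewrite wt.
        by split=> //; rewrite aw.
      move=> [[Uw /andP[aw ws]]|/[dup] wst /andP[sw wt]].
        by split=> //; rewrite aw/=; lra.
      split; first by apply: stU; rewrite /= in_itv.
      by rewrite wt andbT; lra.
    rewrite measureU//=; [|exact: measurableI|].
      rewrite leeD// lebesgue_measure_itv/= lte_fin.
      case: ifPn => [_|]; first by rewrite -EFinB.
      by rewrite -leNgt lee_fin; lra.
    apply/seteqP; split=> // w /= [];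
      rewrite !in_itv/= => -[_ /andP[_ ws]] /andP[sw _].
    by move: sw; rewrite ltNge ws.
  - rewrite (sumE x y 0 (fun p q => `|c q - c p|)).
    have -> : c t - c a = (c t - c s) + (c s - c a) by rewrite addrA subrK.
    rewrite (le_trans (ler_normD _ _))//.
    have := F_nd s t; move=> /(_ _)/wrap[|Fst]; first lra.
    have : 0 <= eps * (t - s) by rewrite mulr_ge0 ?(ltW eps0)//; lra.
    lra.
have nNz : ~ N z by move=> Nz; apply: Uz; apply: NU; left.
have za : z <> a by move=> za; apply: Uz; apply: NU; right.
have az : a < z.
  by rewrite lt_neqAle eq_sym; apply/andP; split; [exact/eqP|case/andP: zab].
have [|v dv [vg dFz]] := PN z nNz az; first by rewrite in_itv.
have eps2 : 0 < eps / 2 by rewrite divr_gt0.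
have [eta1 eta10 H1] := is_derive_straddle dv eps2.
have [eta2 eta20 H2] := is_derive_straddle dFz eps2.
exists (Num.min eta1 eta2); first by rewrite lt_min eta10.
move=> s t as_ etas sz zt teta tb; apply: step_gap => //; first lra.
have [l1 l2] : Num.min eta1 eta2 <= eta1 /\ Num.min eta1 eta2 <= eta2.
  by rewrite !ge_min !lexx orbT.
have := H1 s t; move=> /(_ _ sz zt _)/wrap[||h1]; [lra..|].
have := H2 s t; move=> /(_ _ sz zt _)/wrap[||]; [lra..|].
rewrite ler_norml => /andP[h2 _].
have h3 : `|(t - s) *: v| <= (t - s) * g z.
  by rewrite normrZ ger0_norm ?ler_wpM2l//; lra.
have h4 := ler_normD (c t - c s - (t - s) *: v) ((t - s) *: v).
rewrite subrK in h4.
rewrite (_ : (t - s) *: g z = (t - s) * g z) in h2; last by [].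
lra.
Qed.

End AbsContinuous.

Section AbsContinuousMore.
Variables (R : realType) (V : normedModType R).
Implicit Types (c : R -> V) (a b : R).

Lemma abs_continuous_uniform c a b : abs_continuous a b c ->
  forall eps : R, 0 < eps -> exists2 delta : R, 0 < delta &
    forall s t, a <= s -> s <= t -> t <= b -> t - s < delta ->
      `|c t - c s| < eps.
Proof.
move=> ac eps /ac[delta delta0 H]; exists delta => // s t as_ st tb ts.
have := H 1%N (fun=> s) (fun=> t); rewrite !big_ord1; apply=> // i j.
by rewrite (ord1 i) (ord1 j) eqxx.
Qed.

Lemma abs_continuous_bounded c a b : a <= b -> abs_continuous a b c ->
  exists2 M : R, 0 <= M & forall t, a <= t <= b -> `|c t| <= M.
Proof.
move=> ab ac; have [delta delta0 H] := abs_continuous_uniform ac ltr01.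
suff [M HM] : exists M, forall t, a <= t <= b -> `|c t| <= M.
  exists `|M| => // t tab; apply: le_trans (ler_norm _); exact: HM.
apply: (@segment_induction _ a b
  (fun e => exists M, forall t, a <= t <= e -> `|c t| <= M)) => //.
  by exists `|c a| => t; rewrite -eq_le => /eqP->.
move=> x xab; exists (delta / 2); first by rewrite divr_gt0.
move=> s t as_ xs sx xt tx tb [M HM]; exists (M + 1) => w /andP[aw wt].
have [ws|sw] := leP w s.
  by have := HM w; rewrite aw ws => /(_ isT); lra.
have := H s w as_ (ltW sw) (le_trans wt tb); move=> /(_ _)/wrap[|Hw]; first lra.
have := HM s; rewrite as_ lexx => /(_ isT) Hs.
have := ler_normD (c w - c s) (c s); rewrite subrK; lra.
Qed.

(** Absolute continuity survives maps that are Lipschitz on a ball containing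
    the curve. *)
Lemma abs_continuous_lipschitz_comp (W : normedModType R) c a b
    (f : V -> W) (M K : R) :
  0 <= K -> (forall t, a <= t <= b -> `|c t| <= M) ->
  (forall y z, `|y| <= M -> `|z| <= M -> `|f z - f y| <= K * `|z - y|) ->
  abs_continuous a b c -> abs_continuous a b (f \o c).
Proof.
move=> K0 cM fK ac eps eps0.
have K1 : 0 < K + 1 by rewrite ltr_wpDl.
have [|delta delta0 H] := ac (eps / (K + 1)); first by rewrite divr_gt0.
exists delta => // k s t st disj len; have := H k s t st disj len.
rewrite ltr_pdivlMr// => /(le_lt_trans _); apply.
rewrite mulr_suml; apply: ler_sum => i _; have [? [? ?]] := st i.
apply: (le_trans (fK _ _ _ _)); [apply: cM; apply/andP; split; lra..|].
by rewrite mulrC ler_wpM2l// lerDl.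
Qed.

End AbsContinuousMore.

(** * Continuously differentiable maps on row vectors *)

Section C1.
Variable R : realType.

Lemma is_derive_of_approx (V : normedModType R) (c : R -> V) (x : R) (v : V) :
  (forall eps : R, 0 < eps -> exists2 eta : R, 0 < eta &
    forall y, `|y - x| < eta -> `|c y - c x - (y - x) *: v| <= eps * `|y - x|)
      ->
  is_derive x 1 c v.
Proof.
move=> cv.
have H : (fun h => h^-1 *: ((c \o shift x) (h *: (1 : R)) - c x)) @ 0^' --> v.
  apply/cvgrPdist_le => eps eps0; have [eta eta0 ceta] := cv _ eps0.
  near=> h.
  have h0 : h != 0 by near: h; exact: nbhs_dnbhs_neq.
  have := ceta (h + x); rewrite addrK => /(_ _)/wrap[|ch].
    by near: h; apply: dnbhs0_lt.
  rewrite /= (_ : h *: 1 = h); last exact: mulr1.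
  rewrite -[v in v - _]scale1r -(mulVf h0) -scalerA -scalerBr.
  by rewrite normrZ normfV ler_pdivrMl ?normr_gt0// mulrC distrC.
by apply: DeriveDef; [apply/cvg_ex; exists v|exact/cvg_lim].
Unshelve. all: by end_near. Qed.

Lemma is_derive_line (V W : normedModType R) (f : V -> W) (y v : V) (s : R) :
  derivable f (y + s *: v) v ->
  is_derive s 1 (fun s => f (y + s *: v)) ('D_v f (y + s *: v)).
Proof.
move=> df.
have E : (fun h => h^-1 *: (((fun s => f (y + s *: v)) \o shift s) (h *: (1 :
  R))
     - f (y + s *: v))) =
   (fun h => h^-1 *: ((f \o shift (y + s *: v)) (h *: v) - f (y + s *: v))).
  apply/funext => h /=; rewrite (_ : h *: 1 = h); last exact: mulr1.
  by rewrite scalerDl addrCA.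
by split; rewrite /derivable /derive E.
Qed.

(** The mean value inequality for vector-valued curves, again by induction along
    the segment. *)
Lemma mean_value_le (V : normedModType R) (c dc : R -> V) (M a b : R) :
  a <= b ->
  (forall s, a <= s <= b -> is_derive s 1 c (dc s) /\ `|dc s| <= M) ->
  `|c b - c a| <= M * (b - a).
Proof.
move=> ab dcM; apply/ler_addgt0Pr => e e0.
pose eps := e / (b - a + 1).
have ba0 : 0 < b - a + 1 by lra.
have eps0 : 0 < eps by rewrite divr_gt0.
have : `|c b - c a| <= (M + eps) * (b - a).
  apply: (@segment_induction _ a b (fun t => `|c t - c a| <= (M + eps) * (t -
    a))) => //.
    by rewrite !subrr normr0 mulr0.
  move=> x xab; have [dx Mx] := dcM x xab.
  have [eta eta0 H] := is_derive_straddle dx eps0.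
  exists eta => // s t as_ xs sx xt tx tb cs.
  have -> : c t - c a = (c t - c s) + (c s - c a) by rewrite addrA subrK.
  rewrite (le_trans (ler_normD _ _))//.
  have h1 := H s t xs sx xt tx.
  have h2 := ler_normD (c t - c s - (t - s) *: dc x) ((t - s) *: dc x).
  rewrite subrK normrZ ger0_norm in h2; last lra.
  have h3 : (t - s) * `|dc x| <= (t - s) * M by apply: ler_wpM2l => //; lra.
  by rewrite mulrDl in cs *; lra.
have : eps * (b - a) + eps = e by rewrite /eps; field; rewrite gt_eqF.
by rewrite mulrDl; lra.
Qed.

Lemma mean_value_dist_le (V : normedModType R) (c dc : R -> V) (M a b : R) :
  (forall s, (a <= s <= b) || (b <= s <= a) ->
    is_derive s 1 c (dc s) /\ `|dc s| <= M) ->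
  `|c b - c a| <= M * `|b - a|.
Proof.
move=> dcM; have [ab|ba] := leP a b.
  rewrite ger0_norm ?subr_ge0//; apply: (mean_value_le (dc := dc) ab) => s sab.
  by apply: dcM; rewrite sab.
rewrite distrC ltr0_norm ?subr_lt0// opprB.
apply: (mean_value_le (dc := dc) (ltW ba)) => s sab.
by apply: dcM; rewrite sab orbT.
Qed.

Variables (n : nat) (W : normedModType R) (f : 'rV[R]_n -> W).
Hypothesis df : forall x v, derivable f x v.
Local Notation e_ j := (delta_mx 0 j : 'rV[R]_n).

Lemma rV_coord_le (x : 'rV[R]_n) j : `|x 0 j| <= `|x|.
Proof.
rewrite [leRHS]/Num.norm/= mx_normrE.
by apply: (le_trans _ (le_bigmax _ _ (0, j))).
Qed.

Lemma rV_norm_le (x : 'rV[R]_n) (M : R) : 0 <= M -> (forall j, `|x 0 j| <= M) ->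
  `|x| <= M.
Proof.
move=> M0 xM; rewrite [leLHS]/Num.norm/= mx_normrE.
by apply: bigmax_le => // -[i j] _ /=; rewrite (ord1 i).
Qed.

(** Go from y to z by changing one coordinate at a time.  Balls of the maximum
    norm are boxes, so the path stays in the ball, and each of its n pieces is
    governed by one partial derivative.  With w = 0 this is a Lipschitz
    estimate, with w j the partial derivatives at p it is strict
    differentiability. *)
Lemma box_affine_approx (p : 'rV[R]_n) (rho M : R) (w : 'I_n -> W) : 
  (forall j x, `|x - p| <= rho -> `|'D_(e_ j) f x - w j| <= M) ->
  forall y z, `|y - p| <= rho -> `|z - p| <= rho ->
  `|f z - f y - \sum_j (z 0 j - y 0 j) *: w j| <= (n%:R * M) * `|z - y|.
Proof.
move=> fw y z yp zp.
have rho0 : 0 <= rho by apply: le_trans yp.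
pose q (k : nat) : 'rV[R]_n := \row_j (if (j < k)%N then z 0 j else y 0 j).
have q0 : q 0%N = y by apply/rowP => j; rewrite mxE.
have qn : q n = z by apply/rowP => j; rewrite mxE ltn_ord.
have qS (k : 'I_n) : q k.+1 = q k + (z 0 k - y 0 k) *: e_ k.
  apply/rowP => j; rewrite !mxE eqxx/= ltnS leq_eqVlt.
  have [->|/negPf jk] := eqVneq j k;
    first by rewrite eqxx ltnn mulr1 addrC subrK.
  by rewrite -val_eqE/= in jk; rewrite jk/= mulr0 addr0.
have step (k : 'I_n) : `|f (q k.+1) - f (q k) - (z 0 k - y 0 k) *: w k| <= M *
  `|z - y|.
  have M0 : 0 <= M by apply: le_trans (fw k y yp).
  pose c s := f (q k + s *: e_ k) - s *: w k.
  have -> : f (q k.+1) - f (q k) - (z 0 k - y 0 k) *: w k = c (z 0 k - y 0 k) -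
    c 0.
    by rewrite /c -qS !scale0r addr0 subr0 addrAC.
  have zy : `|z 0 k - y 0 k - 0| <= `|z - y|.
    by have := rV_coord_le (z - y) k; rewrite !mxE subr0.
  apply: le_trans (ler_wpM2l M0 zy).
  apply: (mean_value_dist_le (dc := fun s => 'D_(e_ k) f (q k + s *: e_ k) - w
    k)) => s sz.
  split.
    have d1 := is_derive_line (@df (q k + s *: e_ k) (e_ k)).
    apply: is_deriveB => //.
    apply: is_derive_of_approx => eps eps0; exists 1 => // t _.
    by rewrite -scalerBl subrr normr0 mulr_ge0// ltW.
  apply: fw; apply: rV_norm_le => // j; rewrite !mxE eqxx/=.
  have yj := le_trans (rV_coord_le (y - p) j) yp.
  have zj := le_trans (rV_coord_le (z - p) j) zp.
  rewrite !mxE in yj zj.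
  have [jk|jk] := eqVneq j k; last by rewrite mulr0 addr0; case: ifP.
  rewrite jk in yj zj *; rewrite ltnn mulr1.
  move: yj zj; rewrite !ler_norml => /andP[? ?] /andP[? ?].
  by case/orP: sz => /andP[? ?]; apply/andP; split; lra.
have -> : f z - f y = \sum_(k < n) (f (q k.+1) - f (q k)).
  rewrite -q0 -[in f z]qn; elim: {yp zp qn qS step} n => [|m IH].
    by rewrite big_ord0 subrr.
  by rewrite big_ord_recr/= -IH addrC addrA subrK.
rewrite -sumrB (le_trans (ler_norm_sum _ _ _))//.
apply: (@le_trans _ _ (\sum_(k < n) M * `|z - y|));
  first by apply: ler_sum => k _.
by rewrite sumr_const card_ord -[leLHS]mulr_natl mulrA.
Qed.

Hypothesis cdf : forall v, continuous ('D_v f).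

Lemma derivative_strict (p : 'rV[R]_n) (eps : R) : 0 < eps ->
  exists2 rho : R, 0 < rho & forall y z, `|y - p| <= rho -> `|z - p| <= rho ->
  `|f z - f y - \sum_j (z 0 j - y 0 j) *: 'D_(e_ j) f p| <= eps * `|z - y|.
Proof.
move=> eps0; pose e' := eps / (n%:R + 1).
have n1 : 0 < n%:R + 1 :> R by rewrite ltr_wpDl.
have e'0 : 0 < e' by rewrite divr_gt0.
have : \forall x \near p, forall j, `|'D_(e_ j) f x - 'D_(e_ j) f p| <= e'.
  apply: (@filter_forall _ _ (fun j x => `|'D_(e_ j) f x - 'D_(e_ j) f p| <=
    e') (nbhs p) _) => j.
  have := @cdf (e_ j) p => /cvgrPdist_le/(_ _ e'0).
  by apply: filterS => x; rewrite distrC.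
move=> /nbhs_ballP[r /= r0 rP]; exists (r / 2); first by rewrite divr_gt0.
move=> y z yp zp.
have := box_affine_approx (w := fun j => 'D_(e_ j) f p) (M := e') _ yp zp.
move=> /(_ _)/wrap[j x xp|H].
  by apply: rP; rewrite -ball_normE /= distrC; lra.
apply: (le_trans H); rewrite ler_wpM2r// /e' mulrCA ler_piMr ?(ltW eps0)//.
by rewrite ler_pdivrMr// mul1r lerDl.
Qed.

(** The chain rule along a curve, from strict differentiability. *)
Lemma is_derive_chain (c : R -> 'rV[R]_n) (t : R) (v : 'rV[R]_n) :
  is_derive t 1 c v ->
  is_derive t 1 (f \o c) (\sum_j v 0 j *: 'D_(e_ j) f (c t)).
Proof.
move=> dc; apply: is_derive_of_approx => eps eps0.
(* e1 is the error allowed for f at c t, and e2 the one for c at t. *)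
pose A := \sum_j `|'D_(e_ j) f (c t)|.
have A0 : 0 <= A by apply: sumr_ge0.
pose e1 := eps / 2 / (`|v| + 1).
have v1 : 0 < `|v| + 1 by rewrite ltr_wpDl.
have e10 : 0 < e1 by rewrite !divr_gt0.
have [rho rho0 strict] := derivative_strict (c t) e10.
pose e2 := Num.min 1 (eps / 2 / (A + 1)).
have A1 : 0 < A + 1 by rewrite ltr_wpDl.
have e20 : 0 < e2 by rewrite lt_min ltr01/= !divr_gt0.
have [eta eta0 cP] := is_derive_approx dc e20.
exists (Num.min eta (rho / (`|v| + 1)));
  first by rewrite lt_min eta0/= divr_gt0.
move=> y; rewrite lt_min => /andP[/cP cy yr].
have cyl : `|c y - c t| <= (`|v| + 1) * `|y - t|.
  have := ler_normD (c y - c t - (y - t) *: v) ((y - t) *: v).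
  rewrite subrK normrZ => /le_trans; apply.
  rewrite mulrDl addrC [`|v| * _]mulrC lerD2l (le_trans cy)//.
  by rewrite ler_wpM2r// ge_min lexx.
have cyr : `|c y - c t| <= rho.
  apply: (le_trans cyl); move: yr; rewrite ltr_pdivlMr// => yr.
  by rewrite mulrC ltW.
have := strict (c t) (c y); rewrite subrr normr0 => /(_ (ltW rho0) cyr) H1.
have -> : (f \o c) y - (f \o c) t - (y - t) *: (\sum_j v 0 j *: 'D_(e_ j) f (c
  t)) =
  (f (c y) - f (c t) - \sum_j (c y 0 j - c t 0 j) *: 'D_(e_ j) f (c t)) +
  \sum_j (c y - c t - (y - t) *: v) 0 j *: 'D_(e_ j) f (c t).
  rewrite [X in _ = _ + X](_ : _ = \sum_j (c y 0 j - c t 0 j) *: 'D_(e_ j) f (c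
    t) -
      (y - t) *: (\sum_j v 0 j *: 'D_(e_ j) f (c t))).
    by rewrite addrA subrK.
  rewrite scaler_sumr -sumrB; apply: eq_bigr => j _.
  by rewrite !mxE scalerBl scalerA.
rewrite (le_trans (ler_normD _ _))//.
have -> : eps * `|y - t| = eps / 2 * `|y - t| + eps / 2 * `|y - t|.
  by rewrite -mulrDl -splitr.
apply: lerD.
  apply: (le_trans H1); apply: (le_trans (ler_wpM2l (ltW e10) cyl)).
  by rewrite mulrA /e1 divfK// gt_eqF.
rewrite (le_trans (ler_norm_sum _ _ _))//.
apply: (@le_trans _ _ (\sum_j (e2 * `|y - t|) * `|'D_(e_ j) f (c t)|)).
  apply: ler_sum => j _; rewrite normrZ ler_wpM2r//.
  by apply: (le_trans (rV_coord_le _ _)).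
rewrite -mulr_sumr -/A mulrAC ler_wpM2r//.
have : e2 * A <= eps / 2 / (A + 1) * A by rewrite ler_wpM2r// ge_min lexx orbT.
move=> /le_trans; apply; rewrite -mulrA ler_piMr ?divr_ge0 ?(ltW eps0)//.
by rewrite mulrC ler_pdivrMr// mul1r lerDl.
Qed.

Lemma rV_continuous_bounded (U : normedModType R) (g : 'rV[R]_n -> U)
    (rho : R) :
  continuous g -> exists2 M : R, 0 <= M & forall x, `|x| <= rho -> `|g x| <= M.
Proof.
move=> cg; have cB : compact [set x : 'rV[R]_n | `|x| <= rho].
  apply: bounded_closed_compact.
    by exists rho; split; [exact: num_real|move=> M rM x /= xr;
      rewrite (le_trans xr) ?ltW].
  by apply: (@closed_comp _ _ (fun x : 'rV[R]_n => `|x|) [set y | y <= rho]);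
    [move=> x _; exact: norm_continuous|exact: closed_le].
have [|M [_ HM]] := @compact_bounded _ U (g @` [set x | `|x| <= rho]).
  apply: continuous_compact => //; exact: continuous_subspaceT.
exists (`|M| + 1) => [|x xr]; first by rewrite addr_ge0.
apply: (HM (`|M| + 1)); last by exists x.
by rewrite (le_lt_trans (ler_norm M))// ltrDl.
Qed.

Lemma derivative_lipschitz_on_ball (rho : R) :
  exists2 K : R, 0 <= K & forall y z, `|y| <= rho -> `|z| <= rho ->
    `|f z - f y| <= K * `|z - y|.
Proof.
have bnd j : exists M : R, 0 <= M /\ forall x, `|x| <= rho -> `|'D_(e_ j) f x|
  <= M.
  by have [M M0 HM] := @rV_continuous_bounded _ _ rho (@cdf (e_ j)); exists M.
have [M HM] := choice bnd.
have M0 : 0 <= \sum_j M j by apply: sumr_ge0 => j _; case: (HM j).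
exists (n%:R * \sum_j M j); first by rewrite mulr_ge0.
move=> y z yr zr.
have := @box_affine_approx 0 rho (\sum_j M j) (fun=> 0) _ y z; rewrite !subr0.
move=> /(_ _ yr zr)/wrap[j x|].
  rewrite !subr0 => xr; apply: (le_trans ((HM j).2 _ xr)).
  rewrite (bigD1 j)//= lerDl; apply: sumr_ge0 => i _; by case: (HM i).
by rewrite big1 ?subr0// => j _; rewrite scaler0.
Qed.

End C1.

(** * Left translations of a Lie group *)

Section LeftTranslation.
Variables (R : realType) (n : nat) (G : lieGroup R n).
Local Notation V := 'rV[R]_n.
Local Notation mulG := (lg_mul G).
Local Notation F := (fun p : (V * V)%type => mulG p.1 p.2).
Local Notation e_ j := (delta_mx 0 j : V).

Let dF (v : V * V) (p : V * V) : derivable F p v.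
Proof. by have [_ /(_ v)[]] := @lg_smooth_mul _ _ G 1. Qed.

Let cdF (v : V * V) : continuous ('D_v F).
Proof. by have [_ /(_ v)[]] := @lg_smooth_mul _ _ G 1. Qed.

Let mul_quotient (q p v : V) :
  (fun h : R => h^-1 *: ((mulG q \o shift p) (h *: v) - mulG q p)) =
  (fun h : R => h^-1 *: ((F \o shift (q, p)) (h *: ((0, v) : (V * V)%type)) - F
    (q, p))).
Proof. by apply/funext => h /=; rewrite scaler0 add0r. Qed.

Lemma derivable_mulg (q p v : V) : derivable (mulG q) p v.
Proof. by rewrite /derivable mul_quotient; exact: dF. Qed.

Lemma derive_mulg (q p v : V) : 'D_v (mulG q) p = 'D_(0, v) F (q, p).
Proof. by rewrite /derive mul_quotient. Qed.

Lemma continuous_derive_mulg (q v : V) : continuous ('D_v (mulG q)).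
Proof.
have -> : 'D_v (mulG q) = 'D_(0, v) F \o (fun p => (q, p)).
  by apply/funext => p; rewrite derive_mulg.
move=> p; apply: continuous_comp; last exact: cdF.
exact: (@cvg_pair _ _ _ (nbhs p) (nbhs q) (nbhs p) _ _ _ (fun=> q) id
  (cvg_cst q) cvg_id).
Qed.

Lemma continuous_left_field (x : V) : continuous (left_field G x).
Proof.
have -> : left_field G x = 'D_(0, x) F \o (fun p => (p, 0)).
  by apply/funext => p; rewrite /left_field derive_mulg.
move=> p; apply: continuous_comp; last exact: cdF.
exact: (@cvg_pair _ _ _ (nbhs p) (nbhs p) (nbhs (0 : V)) _ _ _ id (fun=> 0)
  cvg_id (cvg_cst _)).
Qed.

Lemma mulg_lipschitz_on_ball (q : V) (rho : R) :
  exists2 K : R, 0 <= K & forall y z : V, `|y| <= rho -> `|z| <= rho ->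
    `|mulG q z - mulG q y| <= K * `|z - y|.
Proof.
exact: (derivative_lipschitz_on_ball (@derivable_mulg q)
  (@continuous_derive_mulg q)).
Qed.

(** Both sides are derivatives at s = 0 of the curve q (p (s x)) = (q p) (s x):
    the left one by the chain rule, the right one by definition. *)
Lemma left_field_invariant (q p x : V) :
  \sum_j left_field G x p 0 j *: 'D_(e_ j) (mulG q) p =
  left_field G x (mulG q p).
Proof.
have line r : is_derive (0 : R) 1 (fun s : R => mulG r (s *: x)) (left_field G
  x r).
  have := @is_derive_line _ _ _ (mulG r) 0 x 0.
  rewrite add0r scale0r => /(_ (@derivable_mulg _ _ _)).
  by under eq_fun do rewrite add0r.
have := is_derive_chain (@derivable_mulg q) (@continuous_derive_mulg q) (line
  p).
rewrite scale0r lg_mulx0.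
have -> : mulG q \o (fun s : R => mulG p (s *: x)) = fun s : R => mulG (mulG q
  p) (s *: x).
  by apply/funext => s /=; rewrite lg_mulA.
move=> /@derive_val <-; have := line (mulG q p); by move=> /@derive_val.
Qed.

Lemma is_derive_left_translate (q : V) (c : R -> V) (t : R) (I : finType)
    (P : pred I) (u : I -> R) (x : I -> V) :
  is_derive t 1 c (\sum_(i | P i) u i *: left_field G (x i) (c t)) ->
  is_derive t 1 (mulG q \o c)
    (\sum_(i | P i) u i *: left_field G (x i) (mulG q (c t))).
Proof.
move=> /(is_derive_chain (@derivable_mulg q) (@continuous_derive_mulg q)).
congr (is_derive _ _ _ _).
under [RHS]eq_bigr do rewrite -left_field_invariant scaler_sumr.
rewrite exchange_big/=; apply: eq_bigr => j _.
rewrite summxE scaler_suml; apply: eq_bigr => i _.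
by rewrite mxE scalerA.
Qed.

End LeftTranslation.

(** * Isometries of the real line and concatenation *)

Section Isometries.
Variable R : realType.
Local Notation mu := (@lebesgue_measure R).
Variables (s e : R).
Hypothesis s1 : s = 1 \/ s = -1.
Local Notation phi := (fun t : R => s * t + e).

Lemma measurable_affine : measurable_fun setT (phi : R -> R).
Proof.
apply: continuous_measurable_fun => x.
apply: cvgD; last exact: cvg_cst.
by apply: cvgMr; exact: cvg_id.
Qed.

(** By uniqueness of Lebesgue measure it is enough to look at intervals. *)
Lemma lebesgue_measure_affine (A : set R) : measurable A ->
  mu (phi @^-1` A) = mu A.
Proof.
move=> mA.
rewrite -[LHS]/(pushforward mu (phi : _ -> measurableTypeR R) A).
apply/esym/lebesgue_measure_unique => //=.
  exact: measurable_affine.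
move=> mphi _ [[x y]] _ <-; rewrite /pushforward.
have -> : phi @^-1` `]x, y]%classic =
    if s == 1 then `]x - e, y - e]%classic else `[e - y, e - x[%classic.
  apply/seteqP; case: s1 => ->; rewrite ?eqxx.
    by split=> t /=; rewrite !in_itv/= => /andP[? ?]; apply/andP; split; lra.
  rewrite (_ : (-1 == 1) = false); last by apply/negbTE; rewrite lt_eqF//; lra.
  by split=> t /=; rewrite !in_itv/= => /andP[? ?]; apply/andP; split; lra.
rewrite [RHS](_ : _ = mu `]x, y]%classic)//.
case: ifPn => _; rewrite !lebesgue_measure_itv/= !lte_fin.
  by rewrite ltrD2r -!EFinD; case: ifP => // _; congr (_%:E); ring.
by rewrite ltrD2l ltrN2 -!EFinD; case: ifP => // _; congr (_%:E); ring.
Qed.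

Lemma negligible_affine (N : set R) : mu.-negligible N ->
  mu.-negligible (phi @^-1` N).
Proof.
move=> [N' [mN' N'0 NN']]; exists (phi @^-1` N'); split.
- by rewrite -[X in measurable X]setTI; apply: measurable_affine.
- by rewrite lebesgue_measure_affine.
- by move=> t; exact: NN'.
Qed.

Lemma ge0_integral_affine (D : set R) (f : R -> \bar R) : measurable D ->
  measurable_fun D f -> (forall x, 0 <= f x)%E ->
  (\int[mu]_(x in phi @^-1` D) f (phi x) = \int[mu]_(x in D) f x)%E.
Proof.
move=> mD mf f0.
pose psi : measurableTypeR R -> measurableTypeR R := phi.
rewrite -[LHS]/(\int[mu]_(x in psi @^-1` D) (f \o psi) x)%E.
rewrite -ge0_integral_pushforward//=; last exact: measurable_affine.
apply: eq_measure_integral => [|mphi A mA _]; first exact: measurable_affine.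
exact: lebesgue_measure_affine.
Qed.

Lemma integrable_affine (D : set R) (f : R -> R) : measurable D ->
  mu.-integrable D (EFin \o f) ->
  mu.-integrable (phi @^-1` D) (EFin \o (f \o phi)).
Proof.
move=> mD /integrableP[mf finf]; apply/integrableP; split.
  apply: (@measurable_comp _ _ _ _ _ _ D (EFin \o f) _ phi) => //.
    by move=> _ [t Dt <-].
  by apply: measurable_funTS; exact: measurable_affine.
rewrite (ge0_integral_affine (f := fun t => `|(f t)%:E|%E))//.
exact: measurableT_comp.
Qed.

Lemma is_derive_affine (V : normedModType R) (c : R -> V) (t : R) (v : V) :
  is_derive (phi t) 1 c v -> is_derive t 1 (c \o phi) (s *: v).
Proof.
move=> dc; apply: is_derive_of_approx => eps eps0.
have [eta eta0 H] := is_derive_approx dc eps0; exists eta => // y yt.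
have E : phi y - phi t = (y - t) * s by rewrite /=; ring.
have N : `|phi y - phi t| = `|y - t|.
  by rewrite E normrM; case: s1 => ->; rewrite ?normrN normr1 mulr1.
by have := H (phi y); rewrite N => /(_ yt); rewrite E scalerA.
Qed.

Lemma abs_continuous_affine (V : normedModType R) (c : R -> V) (a b a' b' : R) :
  (forall t, a' <= t <= b' -> a <= phi t <= b) ->
  abs_continuous a b c -> abs_continuous a' b' (c \o phi).
Proof.
move=> phiab ac eps /ac[delta delta0 H]; exists delta => // k x y xy disj len.
case: s1 => s1'.
  have := H k (fun i => phi (x i)) (fun i => phi (y i)); apply.
  - move=> i; have [? [? ?]] := xy i.
    have /phiab/andP[? ?] : a' <= x i <= b' by apply/andP; split; lra.
    have /phiab/andP[? ?] : a' <= y i <= b' by apply/andP; split; lra.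
    by split=> //; split=> //; rewrite s1'; lra.
  - by move=> i j /disj[]; rewrite s1' => ?; [left|right]; lra.
  - by rewrite s1'; under eq_bigr do rewrite !mul1r opprD addrACA subrr addr0.
have := H k (fun i => phi (y i)) (fun i => phi (x i)).
under [X in _ -> X < eps]eq_bigr do rewrite distrC; apply.
- move=> i; have [? [? ?]] := xy i.
  have /phiab/andP[? ?] : a' <= x i <= b' by apply/andP; split; lra.
  have /phiab/andP[? ?] : a' <= y i <= b' by apply/andP; split; lra.
  by split=> //; split=> //; rewrite s1'; lra.
- by move=> i j /disj[]; rewrite s1' => ?; [right|left]; lra.
- move: len; congr (_ < _); apply: eq_bigr => i _; rewrite s1'; ring.
Qed.

End Isometries.

Section Glue.
Variable R : realType.
Local Notation mu := (@lebesgue_measure R).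

Definition glue (X : Type) (b : R) (f g : R -> X) (t : R) : X :=
  if t <= b then f t else g t.

Lemma glueL (X : Type) b (f g : R -> X) t : t <= b -> glue b f g t = f t.
Proof. by rewrite /glue => ->. Qed.

Lemma glueR (X : Type) b (f g : R -> X) t : b < t -> glue b f g t = g t.
Proof. by rewrite /glue ltNge => /negPf->. Qed.

Variables (a b e : R).
Hypotheses (ab : a < b) (be : b < e).

Let mitv (i : interval R) : measurable ([set` i] : set (measurableTypeR R)).
Proof. exact: measurable_itv. Qed.

Let itv_split : `[a, e]%classic = `[a, b]%classic `|` `]b, e]%classic.
Proof.
apply/seteqP; split=> t /=; rewrite !in_itv/=.
  by move=> /andP[at_ te]; have [tb|bt] := leP t b; [left|right];
    rewrite ?at_ ?te.
by case=> /andP[h1 h2]; apply/andP; split; move: h1 h2 ab be => /=; lra.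
Qed.

Let itv_disj : [disjoint `[a, b]%classic & `]b, e]%classic].
Proof.
apply/eqP/seteqP; split=> // t [/=];
  rewrite !in_itv/= => /andP[_ tb] /andP[bt _].
by move: tb; rewrite leNgt bt.
Qed.

Lemma integrable_glue (f g : R -> R) : mu.-integrable `[a, b] (EFin \o f) ->
  mu.-integrable `[b, e] (EFin \o g) ->
  mu.-integrable `[a, e] (EFin \o glue b f g).
Proof.
move=> intf intg.
have {}intg : mu.-integrable `]b, e] (EFin \o g).
  by apply: integrableS intg => //; apply: subset_itvr; rewrite bnd_simp.
have := integrableD measurableT ((integrable_mkcond _ (mitv _)).1 intf)
  ((integrable_mkcond _ (mitv _)).1 intg).
move=> H; apply/(integrable_mkcond _ (mitv _));
  apply: eq_integrable H => // t _.
rewrite itv_split !patchE in_setU.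
case: (boolP (t \in `[a, b]%classic)) => tab; last first.
  case: ifPn => //=; last by rewrite add0e.
  rewrite add0e inE/= in_itv/= => /andP[bt _]; by rewrite glueR.
rewrite ifF; last first.
  apply/negbTE/negP => tbe.
  have : (`[a, b]%classic `&` `]b, e]%classic) t by split; exact: set_mem.
  by move/eqP: itv_disj => ->.
move: tab; rewrite adde0 inE/= in_itv/= => /andP[_ tb].
by rewrite glueL.
Qed.

Lemma ge0_integral_glue (f g h : R -> \bar R) :
  measurable_fun `[a, b] f -> measurable_fun `[b, e] g ->
  (forall t, t <= b -> h t = f t) -> (forall t, b < t -> h t = g t) ->
  (forall t, 0 <= h t)%E ->
  (\int[mu]_(t in `[a, e]) h t =
   \int[mu]_(t in `[a, b]) f t + \int[mu]_(t in `[b, e]) g t)%E.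
Proof.
move=> mf mg hf hg h0.
have mg' : measurable_fun `]b, e] g.
  by apply: measurable_funS mg => //; apply: subset_itvr; rewrite bnd_simp.
rewrite itv_split ge0_integral_setU//; last first.
  apply/measurable_funU => //; split.
    apply: eq_measurable_fun mf => t; rewrite inE/= in_itv/= => /andP[_ tb].
    by rewrite hf.
  apply: eq_measurable_fun mg' => t; rewrite inE/= in_itv/= => /andP[bt _].
  by rewrite hg.
congr (_ + _)%E.
  by apply: eq_integral => t; rewrite inE/= in_itv/= => /andP[_ tb]; rewrite hf.
rewrite -integral_itv_obnd_cbnd//.
by apply: eq_integral => t; rewrite inE/= in_itv/= => /andP[bt _]; rewrite hg.
Qed.

(** Cut each interval [x, y] of a family at b: the parts min x b .. min y b and
    max x b .. max y b form families on the two sides. *)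
Lemma abs_continuous_glue (V : normedModType R) (c d : R -> V) :
  abs_continuous a b c -> abs_continuous b e d -> c b = d b ->
  abs_continuous a e (glue b c d).
Proof.
move=> acc acd cd eps eps0.
have e20 : 0 < eps / 2 by rewrite divr_gt0.
have [d1 d10 H1] := acc _ e20; have [d2 d20 H2] := acd _ e20.
exists (Num.min d1 d2); first by rewrite lt_min d10.
move=> k x y xy disj; rewrite lt_min => /andP[len1 len2].
have K1 := H1 k (fun i => Num.min (x i) b) (fun i => Num.min (y i) b).
have K2 := H2 k (fun i => Num.max (x i) b) (fun i => Num.max (y i) b).
have le_len1 : \sum_(i < k) (Num.min (y i) b - Num.min (x i) b) <= \sum_(i < k)
  (y i - x i).
  apply: ler_sum => i _; have [_ [? _]] := xy i.
  by rewrite /Num.min; do 2 case: ifPn; rewrite -?leNgt => ? ?; lra.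
have le_len2 : \sum_(i < k) (Num.max (y i) b - Num.max (x i) b) <= \sum_(i < k)
  (y i - x i).
  apply: ler_sum => i _; have [_ [? _]] := xy i.
  by rewrite /Num.max; do 2 case: ifPn; rewrite -?leNgt => ? ?; lra.
have {}K1 := K1 _ _ (le_lt_trans le_len1 len1).
have {}K2 := K2 _ _ (le_lt_trans le_len2 len2).
apply: (@le_lt_trans _ _ (\sum_(i < k) `|c (Num.min (y i) b) - c (Num.min (x i)
  b)| +
   \sum_(i < k) `|d (Num.max (y i) b) - d (Num.max (x i) b)|)).
  rewrite -big_split/=; apply: ler_sum => i _; have [_ [xiy _]] := xy i.
  apply: le_trans (ler_normD _ _).
  have [yb|] := boolP (y i <= b); last rewrite -ltNge => yb.
    have xb := le_trans xiy yb.
    by rewrite !glueL// !min_l// !max_r// subrr addr0.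
  have [xb|] := boolP (x i <= b); last rewrite -ltNge => xb.
    rewrite (glueL _ _ xb) (glueR _ _ yb) (min_l xb) (max_r xb).
    rewrite (min_r (ltW yb)) (max_l (ltW yb)).
    by rewrite [in leRHS]addrC cd addrA subrK.
  by rewrite (glueR _ _ xb) (glueR _ _ yb) (min_r (ltW xb)) (min_r (ltW yb))
    (max_l (ltW xb)) (max_l (ltW yb)) subrr add0r.
have -> : eps = eps / 2 + eps / 2 by rewrite -splitr.
apply: ltrD; [apply: K1|apply: K2].
- move=> i; have [? [? ?]] := xy i; rewrite /Num.min.
  by do 2 case: ifPn; rewrite -?leNgt => ? ?; have := ab; have := be; lra.
- move=> i j /disj[]; [left|right]; rewrite /Num.min;
  do 2 case: ifPn; rewrite -?leNgt => ? ?; have := ab; have := be; lra.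
- move=> i; have [? [? ?]] := xy i; rewrite /Num.max.
  by do 2 case: ifPn; rewrite -?leNgt => ? ?; have := ab; have := be; lra.
- move=> i j /disj[]; [left|right]; rewrite /Num.max;
  do 2 case: ifPn; rewrite -?leNgt => ? ?; have := ab; have := be; lra.
Qed.

End Glue.

(** * Horizontal curves *)

Section Horizontal.
Variables (R : realType) (G : carnotGroup R).
Local Notation T := (cg_carrier G).
Local Notation mu := (@lebesgue_measure R).
Local Notation mulG := (lg_mul G).
Implicit Types (u : 'I_(cg_dim G) -> R -> R) (c : R -> T) (a b : R).

Definition speed u t : R := Num.sqrt (\sum_(j | cg_deg j == 1%N) u j t ^+ 2).

Lemma speed_ge0 u t : 0 <= speed u t.
Proof. exact: sqrtr_ge0. Qed.

Lemma control_le_speed u t j : cg_deg j = 1%N -> `|u j t| <= speed u t.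
Proof.
move=> j1; rewrite -sqrtr_sqr /speed ler_sqrt ?sumr_ge0// => [|i _].
  rewrite (bigD1 j)/= ?j1// lerDl sumr_ge0// => i _; exact: sqr_ge0.
exact: sqr_ge0.
Qed.

Lemma measurable_speed (D : set R) u :
  (forall j, cg_deg j = 1%N -> measurable_fun D (u j)) ->
  measurable_fun D (EFin \o speed u).
Proof.
move=> mu_; apply/measurable_EFinP.
apply: (@measurableT_comp _ _ _ _ _ _ (@Num.sqrt R)).
  by apply: continuous_measurable_fun; exact: sqrt_continuous.
under eq_fun do rewrite big_mkcond.
apply: measurable_sum => j; case: eqP => [/mu_ mj|_];
  last exact: measurable_cst.
exact: measurable_funX.
Qed.

Lemma horizontal_measurable a b c u j : horizontal a b c u -> cg_deg j = 1%N ->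
  measurable_fun `[a, b] (u j).
Proof. by move=> [_ iu _] /iu /integrableP[/measurable_EFinP]. Qed.

Lemma horizontal_speed_measurable a b c u : horizontal a b c u ->
  measurable_fun `[a, b] (EFin \o speed u).
Proof.
by move=> hc; apply: measurable_speed => j; exact: horizontal_measurable hc.
Qed.

(** The derivative of t |-> c (s t + e) is s times that of c, whence the factor
    s in the controls; it does not change their Euclidean norm. *)
Lemma horizontal_affine (s e : R) a b a' b' c u : s = 1 \/ s = -1 ->
  (fun t : R => s * t + e) @^-1` `[a, b] = `[a', b']%classic ->
  horizontal a b c u ->
  let u' j (t : R) := s * u j (s * t + e) in
  horizontal a' b' (c \o (fun t => s * t + e)) u' /\
  curve_length a' b' u' = curve_length a b u.
Proof.
move=> s1 pre hc u'; have [ac iu dc] := hc; split; first split.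
- apply: (abs_continuous_affine s1) ac => t tab.
  have : `[a', b']%classic t by rewrite /= in_itv.
  by rewrite -pre /= in_itv.
- move=> j /iu iuj.
  have iphi := integrable_affine e s1 (measurable_itv `[a, b]) iuj.
  have mab : measurable (`[a', b']%classic : set (measurableTypeR R)).
    exact: measurable_itv.
  rewrite pre in iphi; exact: (integrableZl mab s iphi).
- have := negligible_affine e s1 dc; apply: negligibleS => t /= H K;
    apply: H => tab.
  have ptab : s * t + e \in `[a, b].
    have : `[a', b']%classic t by [].
    by rewrite -pre.
  have := is_derive_affine s1 (K ptab); congr (is_derive _ _ _ _).
  by rewrite scaler_sumr; apply: eq_bigr => j _; rewrite scalerA.
rewrite /curve_length -pre.
rewrite -(ge0_integral_affine e s1 (measurable_itv `[a, b])
  (horizontal_speed_measurable hc)).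
  apply: eq_integral => t _; congr (Num.sqrt _)%:E; apply: eq_bigr => j _.
  rewrite /u' exprMn; case: s1 => ->; by rewrite ?sqrrN expr1n mul1r.
by move=> t; rewrite lee_fin speed_ge0.
Qed.

(** The distance [cc_dist x y] is the infimum of the l with [joined x y l]. *)
Definition joined (x y : T) (l : \bar R) := exists a b c u,
  [/\ a < b, horizontal a b c u, c a = x, c b = y & l = curve_length a b u].

Lemma curve_length_ge0 a b u : (0 <= curve_length a b u)%E.
Proof. by apply: integral_ge0 => t _; rewrite lee_fin speed_ge0. Qed.

Lemma joined_refl x : joined x x 0.
Proof.
exists 0, 1, (fun=> x), (fun _ _ => 0); split=> //; last first.
  rewrite /curve_length integral0_eq// => t _.
  by rewrite big1 ?sqrtr0// => j _; rewrite expr0n.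
split.
- move=> eps eps0; exists 1 => // k s t _ _ _.
  by rewrite big1// => i _; rewrite subrr normr0.
- by move=> j _; exact: (integrable0 mu `[0, 1]).
- apply: aeW => t _; rewrite big1; last by move=> j _; rewrite scale0r.
  exact: is_derive_cst.
Qed.

Lemma joined_affine (s e : R) a b a' b' c u : s = 1 \/ s = -1 ->
  (fun t : R => s * t + e) @^-1` `[a, b] = `[a', b']%classic -> a' < b' ->
  horizontal a b c u -> 
  joined (c (s * a' + e)) (c (s * b' + e)) (curve_length a b u).
Proof.
move=> s1 pre ab' hc; have [hc' <-] := horizontal_affine s1 pre hc.
by exists a', b', (c \o (fun t => s * t + e)), (fun j t => s * u j (s * t + e)).
Qed.

(** Traverse the curve backwards. *)
Lemma joined_sym x y l : joined x y l -> joined y x l.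
Proof.
move=> [a [b [c [u [ab hc <- <- ->]]]]].
have := @joined_affine (-1) 0 a b (- b) (- a) c u.
rewrite !mulrNN !mul1r !addr0; apply=> //.
- by right.
- by apply/seteqP; split=> t /=; rewrite !in_itv/= => /andP[? ?];
    apply/andP; split; lra.
- by rewrite ltrN2.
Qed.

(** Shift the time of the second curve so that it starts when the first ends. *)
Lemma joined_trans x y z l m :
  joined x y l -> joined y z m -> joined x z (l + m)%E.
Proof.
move=> [a [b [c [u [ab hc cx cy ->]]]]].
move=> [a2 [b2 [c2 [u2 [ab2 hc2 cx2 cy2 ->]]]]].
pose sft := a2 - b; pose e := b2 - sft.
have be : b < e by rewrite /e /sft; lra.
have pre : (fun t : R => 1 * t + sft) @^-1` `[a2, b2] = `[b, e]%classic.
  by apply/seteqP; split=> t /=; rewrite !in_itv/= /e /sft => /andP[? ?];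
     apply/andP; split; lra.
have [hd <-] := horizontal_affine (or_introl erefl) pre hc2.
set d := c2 \o _ in hd; set v := (fun j t => _) in hd *.
have db : d b = y by rewrite /d /= /sft mul1r addrC subrK.
have de : d e = z by rewrite /d /= /e mul1r subrK.
have [acc iu dc] := hc; have [acd iv dd] := hd.
exists a, e, (glue b c d), (fun j => glue b (u j) (v j)); split.
- lra.
- split.
  + by apply: abs_continuous_glue => //; rewrite cy db.
  + by move=> j j1; apply: integrable_glue => //; [exact: iu|exact: iv].
  + have negb : mu.-negligible [set b].
      apply/negligibleP => //; exact: lebesgue_measure_set1.
    have := negligibleU (negligibleU dc dd) negb; apply: negligibleS => t /= H.
    apply: contrapT => H'; apply: H => tae; rewrite in_itv/= in tae.
    have [atp tep] := andP tae.
    have [tb|bt|tb] := ltgtP t b.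
    * have Hc : is_derive t 1 c (\sum_(j | cg_deg j == 1%N) u j t *:
        basis_field j (c t)).
        apply: contrapT => Hc; apply: H'; left; left => /= K; apply: Hc;
          apply: K.
        by rewrite in_itv/= atp ltW.
      rewrite (eq_bigr (fun j => u j t *: basis_field j (c t))); last first.
        by move=> j _; rewrite !glueL// ltW.
      apply: near_eq_is_derive Hc.
      near=> w; rewrite glueL// ltW//; near: w; exact: lt_nbhsl.
    * have Hc : is_derive t 1 d (\sum_(j | cg_deg j == 1%N) v j t *:
        basis_field j (d t)).
        apply: contrapT => Hc; apply: H'; left; right => /= K; apply: Hc;
          apply: K.
        by rewrite in_itv/= tep ltW.
      rewrite (eq_bigr (fun j => v j t *: basis_field j (d t))); last first.
        by move=> j _; rewrite !glueR.
      apply: near_eq_is_derive Hc.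
      near=> w; rewrite glueR//; near: w; exact: lt_nbhsr.
    * by exfalso; apply: H'; right.
- by rewrite glueL// ltW.
- by rewrite glueR.
- rewrite /curve_length.
  rewrite (ge0_integral_glue (f := EFin \o speed u) (g := EFin \o speed v) ab
    be)//.
  + exact: horizontal_speed_measurable hc.
  + exact: horizontal_speed_measurable hd.
  + by move=> t tb; congr (Num.sqrt _)%:E; apply: eq_bigr => j _; rewrite glueL.
  + by move=> t tb; congr (Num.sqrt _)%:E; apply: eq_bigr => j _; rewrite glueR.
Unshelve. all: by end_near. Qed.

(** Translate the curve and keep the controls. *)
Lemma joined_mul q x y l : joined x y l -> joined (mulG q x) (mulG q y) l.
Proof.
move=> [a [b [c [u [ab [ac iu dc] <- <- ->]]]]].
exists a, b, (mulG q \o c), u; split; [exact: ab| |exact: erefl..].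
split; last 1 first.
- apply: filterS dc; first exact: (ae_filter_ringOfSetsType mu).
  by move=> t H /H; exact: is_derive_left_translate.
- have [M M0 cM] := abs_continuous_bounded (ltW ab) ac.
  have [K K0 mulK] := mulg_lipschitz_on_ball G q M.
  exact: (abs_continuous_lipschitz_comp K0 cM mulK).
- exact: iu.
Qed.

(** In exponential coordinates the ray s |-> s e_j is an integral curve of the
    field X_j. *)
Lemma joined_exp (j : 'I_(cg_dim G)) (t : R) : cg_deg j = 1%N -> 0 < t ->
  joined 0 (t *: delta_mx 0 j : T) t%:E.
Proof.
move=> j1 t0; exists 0, t, (fun s => s *: delta_mx 0 j), (fun i _ => (i ==
  j)%:R).
have dline (s : R) : is_derive s 1 (fun s : R => s *: (delta_mx 0 j : T))
    (left_field G (delta_mx 0 j) (s *: delta_mx 0 j)).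
  exact: cg_exp.
split=> //.
- split.
  + move=> eps eps0; exists (eps / (`|delta_mx 0 j : T| + 1)).
      by rewrite divr_gt0// ltr_wpDl.
    move=> k x y xy _; rewrite ltr_pdivlMr ?ltr_wpDl// => /(le_lt_trans _);
      apply.
    rewrite mulr_suml; apply: ler_sum => i _; have [_ [? _]] := xy i.
    by rewrite -scalerBl normrZ ger0_norm ?subr_ge0// ler_wpM2l ?subr_ge0//
      lerDl.
  + move=> i _; apply: continuous_compact_integrable;
      first exact: segment_compact.
    by apply: continuous_subspaceT => w; exact: cvg_cst.
  + apply: aeW => s _; rewrite (bigD1 j)/= ?j1// eqxx scale1r big1 ?addr0;
      first exact: dline.
    by move=> i /andP[_ /negPf->]; rewrite scale0r.
- by rewrite scale0r.
- rewrite /curve_length (eq_integral (cst 1%E)).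
    rewrite integral_cst//= mul1e lebesgue_measure_itv/= lte_fin t0 oppr0 adde0.
    by [].
  move=> s _; rewrite (bigD1 j)/= ?j1// eqxx expr1n big1 ?addr0 ?sqrtr1//.
  by move=> i /andP[_ /negPf->]; rewrite expr0n.
Qed.

Lemma horizontal_norm_le (C : R) a b c u : a <= b -> horizontal a b c u ->
  (forall p : T, `|p| <= 1 ->
    \sum_(j | cg_deg j == 1%N) `|basis_field j p| <= C) ->
  mu.-integrable `[a, b] (EFin \o speed u) ->
  (forall t, a <= t <= b -> `|c t| <= 1) ->
  `|c b - c a| <= C * \int[mu]_(t in `[a, b]) speed u t.
Proof.
move=> ab hc XC ispeed c1.
have C0 : 0 <= C.
  by apply: le_trans (XC 0 _); rewrite ?normr0// sumr_ge0.
have mab : measurable (`[a, b]%classic : set (measurableTypeR R)).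
  exact: measurable_itv.
pose g t := C * (speed u \_ `[a, b]) t.
have ig : mu.-integrable setT (EFin \o g).
  have := (integrable_mkcond _ mab).1 ispeed; rewrite restrict_EFin => H.
  exact: (integrableZl measurableT C H).
have g0 t : 0 <= g t.
  by rewrite mulr_ge0// patchE; case: ifP => // _; exact: speed_ge0.
have [ac _ dc] := hc.
have := abs_continuous_le_integral ab ac ig g0.
move=> /(_ _)/wrap[|].
  apply: filterS dc; first exact: (ae_filter_ringOfSetsType mu).
  move=> t H tab.
  exists (\sum_(j | cg_deg j == 1%N) u j t *: basis_field j (c t)).
    exact: H.
  rewrite /g patchE mem_set//.
  apply: (@le_trans _ _
    (\sum_(j | cg_deg j == 1%N) speed u t * `|basis_field j (c t)|)).
    rewrite (le_trans (ler_norm_sum _ _ _))//; apply: ler_sum => j /eqP j1.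
    by rewrite normrZ ler_wpM2r// control_le_speed.
  rewrite -mulr_sumr mulrC ler_wpM2r ?speed_ge0//; apply: XC; apply: c1.
  by move: tab; rewrite in_itv.
move=> /le_trans; apply; rewrite le_eqVlt; apply/orP; left; apply/eqP.
rewrite -RintegralZl//; apply: eq_Rintegral => t tab.
by rewrite /g patchE tab.
Qed.

Lemma horizontal_fields_bounded : exists2 C : R, 0 < C &
  forall p : T, `|p| <= 1 -> \sum_(j | cg_deg j == 1%N) `|basis_field j p| <= C.
Proof.
have bnd (j : 'I_(cg_dim G)) : exists M : R, 0 <= M /\
    forall p : T, `|p| <= 1 -> `|basis_field j p| <= M.
  have [M M0 HM] := rV_continuous_bounded 1
    (continuous_left_field (G := G) (x := delta_mx 0 j)).
  by exists M.
have [M HM] := choice bnd.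
have sM : 0 <= \sum_(j | cg_deg j == 1%N) M j.
  by apply: sumr_ge0 => j _; case: (HM j).
exists (\sum_(j | cg_deg j == 1%N) M j + 1); first by rewrite ltr_wpDl.
move=> p p1; apply: (@le_trans _ _ (\sum_(j | cg_deg j == 1%N) M j)).
  by apply: ler_sum => j _; exact: (HM j).2.
by rewrite lerDl.
Qed.

(** Here C bounds the horizontal fields on the unit ball.  As long as the curve
    stays in the unit ball its norm is at most C * l < 1, so it cannot leave the
    ball: this is proved by induction along the segment. *)
Lemma joined_norm_le : exists2 C : R, 0 < C &
  forall (y : T) (l : R), joined 0 y l%:E -> C * l < 1 -> `|y| <= C * l.
Proof.
have [C C0 XC] := horizontal_fields_bounded; exists C => // y l.
move=> [a [b [c [u [ab hc ca <- lE]]]]] Cl.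
have mspeed := horizontal_speed_measurable hc.
have mab e : measurable (`[a, e]%classic : set (measurableTypeR R)).
  exact: measurable_itv.
have ispeed : mu.-integrable `[a, b] (EFin \o speed u).
  apply/integrableP; split=> //.
  have -> : (\int[mu]_(x in `[a, b]) `|(EFin \o speed u) x| = l%:E)%E.
    rewrite lE; apply: eq_integral => t _ /=.
    by rewrite ger0_norm ?speed_ge0.
  by rewrite ltry.
have [ac iu dc] := hc.
have sub e : e <= b -> `[a, e] `<=` `[a, b]%classic.
  by move=> eb; apply: subset_itvl; rewrite bnd_simp.
have key e : a <= e -> e <= b -> (forall t, a <= t <= e -> `|c t| <= 1) ->
    `|c e| <= C * l.
  move=> ae eb c1.
  have hce : horizontal a e c u.
    split.
    - move=> eps /ac[d d0 H]; exists d => // k x y' xy; apply: H.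
      by move=> i; have [? [? ?]] := xy i; split=> //; split=> //; lra.
    - by move=> j /iu; apply: integrableS => //; exact: sub.
    - apply: filterS dc; first exact: (ae_filter_ringOfSetsType mu).
      by move=> t H tae; apply: H; apply: sub tae.
  have ispeede : mu.-integrable `[a, e] (EFin \o speed u).
    by apply: integrableS ispeed => //; exact: sub.
  have := horizontal_norm_le ae hce XC ispeede c1;
    rewrite ca subr0 => /le_trans; apply.
  rewrite ler_wpM2l ?(ltW C0)//.
  rewrite -lee_fin /Rintegral fineK; last exact: integrable_fin_num.
  rewrite lE; apply: ge0_subset_integral => //; last exact: sub.
  by move=> t _; rewrite lee_fin speed_ge0.
suff : forall t, a <= t <= b -> `|c t| <= C * l by apply; rewrite lexx ltW.
apply: (@segment_induction _ a b (fun e => forall t, a <= t <= e -> `|c t| <= C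
  * l)).
- exact: ltW.
- move=> t; rewrite -eq_le => /eqP <-; rewrite ca normr0 mulr_ge0 ?(ltW C0)//.
  by rewrite -lee_fin lE curve_length_ge0.
(* The room between C * l and 1 keeps c in the unit ball for a short time past
   s, and there the integral bound gives C * l again. *)
- have Cl0 : 0 < 1 - C * l by lra.
  have [d d0 H] := abs_continuous_uniform ac Cl0.
  move=> x xab; exists (d / 2); first by rewrite divr_gt0.
  move=> s t as_ xs sx xt tx tb Hs w /andP[aw wt].
  apply: key => //; first lra.
  move=> v /andP[av vw]; have [vs|sv] := leP v s.
    by apply: (le_trans (Hs v _)); [rewrite av|lra].
  have := H s v as_ (ltW sv); move=> /(_ _ _)/wrap[||Hv]; [lra..|].
  have := Hs s; rewrite as_ lexx => /(_ isT) Hss.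
  by have := ler_normD (c v - c s) (c s); rewrite subrK; lra.
Qed.

End Horizontal.

(** * The Carnot-Caratheodory distance truncated at 1 *)

Section TruncatedDistance.
Variables (R : realType) (G : carnotGroup R).
Local Notation T := (cg_carrier G).
Local Notation mulG := (lg_mul G).
Local Notation invG := (lg_inv G).
Implicit Types x y z : T.

(** This is min (d_c (x, y), 1), as an infimum of real numbers. *)
Definition trunc_dist (x y : T) : R := inf [set v | v = 1 \/ joined x y v%:E].
Local Notation D := trunc_dist.

Let joined_ge0 (x y : T) l : joined x y l -> (0 <= l)%E.
Proof. by move=> [a [b [c [u [_ _ _ _ ->]]]]]; exact: curve_length_ge0. Qed.

Let D_has_inf x y : has_inf [set v | v = 1 \/ joined x y v%:E].
Proof.
split; first by exists 1; left.
by exists 0 => v [->//|/joined_ge0]; rewrite lee_fin.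
Qed.

Lemma trunc_dist_le1 x y : D x y <= 1.
Proof. by apply: ge_inf; [exact: (D_has_inf _ _).2|left]. Qed.

Lemma trunc_dist_le x y v : joined x y v%:E -> D x y <= v.
Proof. by move=> xy; apply: ge_inf; [exact: (D_has_inf _ _).2|right]. Qed.

Lemma le_trunc_dist x y v : v <= 1 -> (forall w, joined x y w%:E -> v <= w) ->
  v <= D x y.
Proof.
move=> v1 vxy; apply: lb_le_inf; first by exists 1; left.
by move=> w [->//|]; exact: vxy.
Qed.

Lemma trunc_dist_ge0 x y : 0 <= D x y.
Proof. by apply: le_trunc_dist => // w /joined_ge0; rewrite lee_fin. Qed.

Lemma trunc_dist_lt x y r : D x y < r -> r <= 1 ->
  exists2 v, joined x y v%:E & v < r.
Proof.
move=> /(inf_lt (D_has_inf x y).1)[v [->|xyv] vr] r1; last by exists v.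
by move: vr; rewrite ltNge r1.
Qed.

Lemma trunc_distxx x : D x x = 0.
Proof.
apply/eqP; rewrite eq_le trunc_dist_ge0 andbT; apply: trunc_dist_le.
exact: joined_refl.
Qed.

Lemma trunc_dist_sym x y : D x y = D y x.
Proof.
by congr inf; apply/seteqP; split=> v [->|/joined_sym]; [left|right|left|right].
Qed.

Lemma trunc_dist_triangle x y z : D x z <= D x y + D y z.
Proof.
have key v w : v = 1 \/ joined x y v%:E -> w = 1 \/ joined y z w%:E ->
    D x z <= v + w.
  move=> [->|xyv]; first by move=> [->|/joined_ge0]; rewrite ?lee_fin;
    have := trunc_dist_le1 x z; lra.
  move=> [->|yzw].
    by have := trunc_dist_le1 x z; have := joined_ge0 xyv; rewrite lee_fin; lra.
  by apply: trunc_dist_le; rewrite EFinD; exact: joined_trans xyv yzw.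
rewrite -lerBlDr; apply: lb_le_inf; first by exists 1; left.
move=> v Hv; rewrite lerBlDr addrC -lerBlDr; apply: lb_le_inf;
  first by exists 1; left.
by move=> w Hw; rewrite lerBlDr addrC; exact: key.
Qed.

Lemma trunc_dist_left q x y : D (mulG q x) (mulG q y) = D x y.
Proof.
congr inf; apply/seteqP; split=> v [->|H]; [by left|right|by left|right].
  by have := joined_mul (invG q) H; rewrite !lg_mulA lg_mulVx !lg_mul0x.
exact: joined_mul.
Qed.

Lemma trunc_dist_le_cc x y : ((D x y)%:E <= cc_dist x y)%E.
Proof.
apply/ereal_infP => l xyl; have := joined_ge0 xyl.
case: l xyl => [l| |] xyl //= _; last by rewrite leey.
by rewrite lee_fin; exact: trunc_dist_le.
Qed.

Lemma cc_dist_trunc x y : D x y < 1 -> cc_dist x y = (D x y)%:E.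
Proof.
move=> D1; apply/eqP; rewrite eq_le trunc_dist_le_cc andbT.
apply/lee_addgt0Pr => e e0.
have [||v xyv vr] := @trunc_dist_lt x y (Num.min 1 (D x y + e)).
- by rewrite lt_min D1 ltrDl.
- by rewrite ge_min lexx.
apply: (@le_trans _ _ v%:E); first by apply: ereal_inf_lbound.
by rewrite -EFinD lee_fin ltW// (lt_le_trans vr)// ge_min lexx orbT.
Qed.

Lemma trunc_dist_norm : exists2 C : R, 0 < C &
  forall h : T, D h 0 < Num.min 1 C^-1 -> `|h| <= C * D h 0.
Proof.
have [C C0 HC] := joined_norm_le G; exists C => // h.
rewrite lt_min => /andP[D1 DC]; rewrite leNgt; apply/negP => hlt.
have [||v hv vr] := @trunc_dist_lt h 0 (Num.min (Num.min 1 C^-1) (C^-1 * `|h|)).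
- by rewrite !lt_min D1 DC/= ltr_pdivlMl.
- by rewrite !ge_min lexx.
move: vr; rewrite !lt_min => /andP[/andP[v1 vC] vh].
have := HC h v (joined_sym hv); rewrite -ltr_pdivlMl// mulr1 => /(_ vC).
by rewrite leNgt -ltr_pdivlMl// vh.
Qed.

Lemma trunc_dist_gt0 x y : x <> y -> 0 < D x y.
Proof.
move=> xy; rewrite lt_neqAle trunc_dist_ge0 andbT eq_sym; apply/eqP => D0.
have [C C0 HC] := trunc_dist_norm.
have := HC (mulG (invG y) x);
  rewrite -(trunc_dist_left y) lg_mulA lg_mulxV lg_mul0x lg_mulx0.
rewrite D0 mulr0 => /(_ _)/wrap[|]; first by rewrite lt_min ltr01 invr_gt0.
rewrite normr_le0 => /eqP H; apply: xy.
by rewrite -(lg_mul0x G x) -(lg_mulxV G y) -lg_mulA H lg_mulx0.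
Qed.

Lemma exists_horizontal_direction : exists j : 'I_(cg_dim G), cg_deg j = 1%N.
Proof.
apply: contrapT => H; apply: (@cg_layer_neq0 _ G 1);
  first by rewrite /= cg_step_gt0.
rewrite /layer_of (@eq_filter _ _ pred0) ?filter_pred0 ?span_nil//.
by move=> j; apply/negP => /eqP j1; apply: H; exists j.
Qed.

(** Take H rho = rho * e_j for a horizontal direction e_j; its norm is at least
    rho, which bounds its distance to 0 from below. *)
Lemma trunc_dist_scale : exists c0 rho0 (H : R -> T),
  [/\ 0 < c0, 0 < rho0 <= 1 &
  forall rho : R, 0 < rho <= rho0 -> c0 * rho <= D (H rho) 0 <= rho].
Proof.
have [C C0 HC] := trunc_dist_norm.
have [j j1] := exists_horizontal_direction.
have m0 : 0 < Num.min 1 C^-1 by rewrite lt_min ltr01 invr_gt0.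
exists C^-1, (Num.min 1 C^-1 / 2), (fun rho => rho *: delta_mx 0 j).
have m1 : Num.min 1 C^-1 <= 1 by rewrite ge_min lexx.
split; [by rewrite invr_gt0|apply/andP; split; lra|].
move=> rho /andP[r0 rr].
have Drho : D (rho *: delta_mx 0 j) 0 <= rho.
  by apply: trunc_dist_le; apply: joined_sym; exact: joined_exp.
rewrite Drho andbT ler_pdivrMl//.
apply: (@le_trans _ _ `|rho *: delta_mx 0 j : T|); last by apply: HC; lra.
have := rV_coord_le (rho *: delta_mx 0 j : T) j.
by rewrite !mxE !eqxx mulr1; apply: le_trans; exact: ler_norm.
Qed.

Lemma porous_trunc (E : set T) : porous (@cc_dist R G) E ->
  exists2 lam : R, 0 < lam & forall a, E a ->
    forall eta : R, 0 < eta -> exists2 z, 0 < D z a < eta &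
      forall y, E y -> lam * D z a <= D z y.
Proof.
move=> [lam [/andP[lam0 lam1] porE]]; exists lam => // a Ea eta eta0.
have [x [xa cvx holes]] := porE a Ea.
have m0 : 0 < Num.min 1 eta by rewrite lt_min ltr01.
have [k kx] : exists k, (cc_dist (x k) a < (Num.min 1 eta)%:E)%E.
  have near0 : nbhs (0%E : \bar R) [set v | (v < (Num.min 1 eta)%:E)%E].
    by apply: open_ereal_lt'; rewrite lte_fin.
  by have [N _ HN] := cvx _ near0; exists N; exact: (HN N (leqnn N)).
have Dx : D (x k) a < Num.min 1 eta.
  by rewrite -lte_fin (le_lt_trans (trunc_dist_le_cc _ _)).
move: Dx; rewrite lt_min => /andP[D1 De].
exists (x k); first by rewrite De trunc_dist_gt0.
move=> y Ey; have [Dy|Dy] := ltP (D (x k) y) 1; last first.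
  by apply: le_trans Dy; have := trunc_dist_ge0 (x k) a; nra.
rewrite leNgt; apply/negP => lt.
have : ([set w | (cc_dist (x k) w < lam%:E * cc_dist (x k) a)%E] `&` E) y.
  by split=> //=; rewrite !cc_dist_trunc// -EFinM lte_fin.
by rewrite holes.
Qed.

(** Small truncated distance to 0 forces small norm, so the limit along
    punctured Euclidean neighbourhoods of 0 applies. *)
Lemma pansu_additive_derivative (f : T -> R) (a : T) :
  pansu_differentiable f a ->
  exists L, additive_derivative mulG 0 D f L a.
Proof.
move=> [L [LM _] dL]; exists L; split=> // eps eps0.
have [C C0 HC] := trunc_dist_norm.
have := dL => /cvgrPdist_le/(_ _ eps0).
rewrite near_withinE => /nbhs_ballP[r /= r0 Hr].
have L0 : L 0 = 0 by have := LM 0 0; rewrite lg_mul0x; lra.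
have m0 : 0 < Num.min (Num.min 1 C^-1) (r / C).
  by rewrite !lt_min ltr01 invr_gt0 C0 divr_gt0.
exists (Num.min (Num.min 1 C^-1) (r / C)) => // p.
rewrite lt_min => /andP[Dp]; rewrite ltr_pdivlMr// => Dr.
have [->|p0] := eqVneq p 0.
  by rewrite lg_mulx0 L0 !subrr normr0 mulr_ge0 ?trunc_dist_ge0// ltW.
have pr : ball 0 r p.
  rewrite -ball_normE /= sub0r normrN (le_lt_trans (HC _ Dp))//.
  by rewrite mulrC.
have D0 : 0 < D p 0 by apply: trunc_dist_gt0; exact/eqP.
have := Hr p pr p0; rewrite cc_dist_trunc; last by move: Dp;
  rewrite lt_min => /andP[].
by rewrite /= sub0r normrN normrM normfV (gtr0_norm D0) ler_pdivrMr.
Qed.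

End TruncatedDistance.

(** * Porous sets and universal differentiability *)

Theorem corollary4p7 (R : realType) (G : carnotGroup R)
    (A : set (cg_carrier G)) :
  universal_differentiability_set A -> ~ sigma_porous (@cc_dist R G) A.
Proof.
move=> uds [E [porE AE]].
have [c0 [rho0 [H [c00 rho01 HP]]]] := trunc_dist_scale G.
have [f flip fE] := nowhere_differentiable (@lg_mulA _ _ G) (@lg_mul0x _ _ G)
  (@lg_mulx0 _ _ G) (@lg_mulxV _ _ G) (@trunc_distxx _ G) (@trunc_dist_sym _ G)
  (@trunc_dist_triangle _ G) (@trunc_dist_left _ G) c00 rho01 HP
  (fun k => porous_trunc (porE k)).
have [|a] := uds f.
  exists 2 => x y; apply: (@le_trans _ _ (2 * trunc_dist x y)%:E).
    by rewrite lee_fin.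
  by rewrite EFinM lee_wpmul2l ?lee_fin// trunc_dist_le_cc.
rewrite AE => -[k _ Eka] /pansu_additive_derivative[L].
exact: fE Eka L.
Qed.
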